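(* In the setting of the context (smooth $f\colon\mathbb{R}^n\to\mathbb{R}$ with non-degenerate critical point $0$ of Morse index $k$, metric $g$ standard at $0$, gluing maps $\gamma_T=\mathcal{N}_T\circ\wp_T\colon\mathcal{U}_+\times\mathcal{U}_-\to\mathbb{W}_T$ for $T\ge T_0$), it holds that $\gamma_T(0_+,0_-)=0_T$. Furthermore, the differential of $\gamma_T$ at $(0_+,0_-)$ is the infinitesimal gluing map $\Gamma_T$: $$d\gamma_T|_{(0_+,0_-)}=\Pi_T\circ d\wp_T|_{(0_+,0_-)}=\Gamma_T\colon\mathbb{E}^+\times\mathbb{E}^-\to\mathbb{E}_T .$$
   Context: Setup. $f\colon\mathbb{R}^n\to\mathbb{R}$ is smooth, $0$ is a non-degenerate critical point of Morse index $k$, $g$ is a smooth Riemannian metric on $\mathbb{R}^n$, Euclidean at $0$, and $\nabla f$ is the $g$-gradient. The Hessian of $f$ at $0$ is $A=\mathrm{diag}(a_1,\dots,a_n)$ with $a_1\ge\dots\ge a_{n-k}>0>a_{n-k+1}\ge\dots\ge a_n$; $\sigma:=\min_\ell|a_\ell|$. Write $\zeta=(\zeta^+,\zeta^-)$ for the splitting $\mathbb{R}^n=\mathbb{R}^{n-k}\times\mathbb{R}^k$. Path spaces. $\mathbb{W}_+=W^{1,2}([0,\infty),\mathbb{R}^n)$, $\mathbb{W}_-=W^{1,2}((-\infty,0],\mathbb{R}^n)$, $\mathbb{W}_T=W^{1,2}([-T,T],\mathbb{R}^n)$, $\mathbb{V}_T=L^2([-T,T],\mathbb{R}^n)$. $\mathcal{F}_T\colon\mathbb{W}_T\to\mathbb{V}_T$,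 $\mathcal{F}_T(w)=\partial_sw+\nabla f(w)$. $\mathcal{W}^{\rm s}\subset\mathbb{W}_+$, $\mathcal{W}^{\rm u}\subset\mathbb{W}_-$, $\mathcal{M}_T\subset\mathbb{W}_T$ are the submanifolds of solutions of $\partial_sw+\nabla f(w)=0$. $0_\pm,0_T$ are the constant paths at $0$. Tangent spaces: $\mathbb{E}^+=T_{0_+}\mathcal{W}^{\rm s}=\{\xi\in\mathbb{W}_+\mid\partial_s\xi+A\xi=0\}$, $\mathbb{E}^-=T_{0_-}\mathcal{W}^{\rm u}=\{\eta\in\mathbb{W}_-\mid\partial_s\eta+A\eta=0\}$, $\mathbb{E}_T=T_{0_T}\mathcal{M}_T=\{\zeta\in\mathbb{W}_T\mid\partial_s\zeta+A\zeta=0\}$. Pre-gluing. Fix a smooth $\beta\colon\mathbb{R}\to[0,1]$ with $\beta(s)=0$ for $s\le-1$ and $\beta(s)=1$ for $s\ge1$. For $T\ge3$ let $\mathcal{P}_T\colon\mathbb{W}_+\times\mathbb{W}_-\to\mathbb{W}_T$, $\mathcal{P}_T(w_+,w_-)(s)=(1-\beta(s+2))w_+(T+s)+\beta(s-2)w_-(-T+s)$, and $\wp_T:=\mathcal{P}_T|_{\mathcal{W}^{\rm s}\times\mathcal{W}^{\rm u}}$. Projection and infinitesimal gluing. $\mathbb{K}_T:=\{\zeta\in\mathbb{W}_T\mid\zeta^+(-T)=0,\ \zeta^-(T)=0\}$ is a complement of $\mathbb{E}_T$ in $\mathbb{W}_T$; $\Pi_T\colon\mathbb{W}_T=\mathbb{E}_T\oplus\mathbb{K}_T\to\mathbb{E}_T$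 is the projection along $\mathbb{K}_T$. The infinitesimal gluing map is $\Gamma_T:=\Pi_T\circ d\wp_T(0_+,0_-)\colon\mathbb{E}^+\times\mathbb{E}^-\to\mathbb{E}_T$. Right inverse. $D_T:=d\mathcal{F}_T(0_T)\colon\zeta\mapsto\partial_s\zeta+A\zeta$ has kernel $\mathbb{E}_T$; $Q_T:=(D_T|_{\mathbb{K}_T})^{-1}\colon\mathbb{V}_T\to\mathbb{K}_T$. Fix $c>0$, independent of $T$, with $\|Q_T\|\le c$ for all $T>0$. Newton-Picard map. Fix $\delta>0$, independent of $T$, such that for every $T\ge1$ each $w\in\mathbb{W}_T$ with $\|w\|_{1,2}<\delta$ satisfies $\|d\nabla f(w(s))-A\|<\frac{1}{4c}$ for all $s\in[-T,T]$. On $U_0(\delta)=\{w\in\mathbb{W}_T\mid\|w\|_{1,2}<\frac{\delta}{8},\ \|\mathcal{F}_T(w)\|_{2}<\frac{\delta}{4c}\}$ the Newton-Picard map $\mathcal{N}_T\colon U_0(\delta)\to\mathbb{W}_T$ assigns to $w$ the unique $z\in\mathbb{W}_T$ with $\mathcal{F}_T(z)=0$, $z-w\in\operatorname{im}Q_T=\mathbb{K}_T$, $\|z\|_{1,2}<\delta$; it is smooth. Gluing map. $\mathcal{U}_+\subset\mathcal{W}^{\rm s}$, $\mathcal{U}_-\subset\mathcal{W}^{\rm u}$ are open neighborhoods of $0_+$, $0_-$, with compact closures $K_\pm$ in $\mathcal{W}^{\rm s}$, $\mathcal{W}^{\rm u}$, such that $\|\wp_T(w_+,w_-)\|_{1,2}<\frac{\delta}{8}$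 for all $w_\pm\in\mathcal{U}_\pm$, $T\ge3$. Fix $\varepsilon\in(0,\sigma)$ and a constant $C$ with $\|\mathcal{F}_T(\wp_T(w_+,w_-))\|_{2}\le Ce^{-\varepsilon T}$ for all $w_\pm\in K_\pm$, $T\ge3$ (such $C$ exists). Fix $T_0\ge3$ with $Ce^{-\varepsilon T_0}<\frac{\delta}{4c}$. For $T\ge T_0$ the gluing map is $\gamma_T:=\mathcal{N}_T\circ\wp_T\colon\mathcal{U}_+\times\mathcal{U}_-\to\mathbb{W}_T$. *)

(* Defs.v *)
From HB Require Import structures.
From mathcomp Require Import all_boot all_order all_algebra.
From mathcomp Require Import all_classical all_reals all_analysis measurable_realfun.
From mathcomp Require Import ring lra.
Import Order.TTheory GRing.Theory Num.Theory.
Import numFieldNormedType.Exports.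
Set Implicit Arguments. Unset Strict Implicit. Unset Printing Implicit Defensive.
Local Open Scope classical_set_scope.
Local Open Scope ring_scope.

(* R^n is 'rV[R]_n. The library norm on it is the sup norm, so the Euclidean
   norm and the operator norm it induces are introduced explicitly. *)
Section calculus.
Context {R : realType}.

(* All iterated directional derivatives exist and are Frechet differentiable. *)
Definition smooth (V W : normedModType R) (F : V -> W) : Prop :=
  forall (vs : seq V) (x : V), differentiable (foldr (fun v h => 'D_v h) F vs) x.

Context {n : nat}.

Definition partials (f : 'rV[R]_n -> R) (x : 'rV[R]_n) : 'rV[R]_n :=
  \row_i 'D_(delta_mx 0 i) f x.

Definition hessian (f : 'rV[R]_n -> R) (x : 'rV[R]_n) : 'M[R]_n :=
  \matrix_(i, j) 'D_(delta_mx 0 j) ('D_(delta_mx 0 i) f) x.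

Definition riemannian_metric (g : 'rV[R]_n -> 'M[R]_n) : Prop :=
  [/\ smooth g, forall x, (g x)^T = g x &
      forall x (v : 'rV[R]_n), v != 0 -> 0 < (v *m g x *m v^T) 0 0].

(* The vector u with u g(x) v^T = df(x) v for all v. *)
Definition gradient (g : 'rV[R]_n -> 'M[R]_n) (f : 'rV[R]_n -> R)
    (x : 'rV[R]_n) : 'rV[R]_n :=
  partials f x *m invmx (g x).

Definition enorm (v : 'rV[R]_n) : R := Num.sqrt (\sum_i v 0 i ^+ 2).

Definition opnorm (L : 'rV[R]_n -> 'rV[R]_n) : R :=
  sup [set enorm (L v) | v in [set v | enorm v <= 1]].

End calculus.

Section submanifold.
Context {R : realType} {V W : normedModType R}.

(* L is the differential at x0 of the map phi on the submanifold M, whose tangent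
   space at x0 is TM: phi agrees on M near x0 with a map defined on the ambient
   space that is Frechet differentiable at x0 and whose differential there
   restricts to L on TM. Values of phi outside M and of L outside TM are
   irrelevant. *)
Definition diff_along (M TM : set V) (x0 : V) (phi : V -> W) (L : V -> W) : Prop :=
  exists Phi : V -> W,
    [/\ \forall x \near x0, M x -> Phi x = phi x, differentiable Phi x0 &
        forall v, TM v -> 'd Phi x0 v = L v].

End submanifold.

Section sobolev.
Context {R : realType} {n : nat}.
Implicit Types (I J : interval R) (u v w : R -> 'rV[R]_n).
Local Notation mu := (@lebesgue_measure R).

Definition L2fun I v :=
  forall i : 'I_n, (fun s => v s 0 i) \_ [set` I] \in Lfun mu 2%:E.

(* Only meaningful on L2fun: the real-valued integral is 0 when infinite. *)
Definition L2norm I v :=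
  Num.sqrt (\int[mu]_(s in [set` I]) \sum_(i < n) v s 0 i ^+ 2).

(* In dimension one a W^{1,2} path is, after passing to its continuous
   representative, the indefinite integral of its L^2 weak derivative. *)
Definition weak_derivative I w v :=
  L2fun I v /\
  forall (i : 'I_n) (s t : R), s \in I -> t \in I -> s <= t ->
    w t 0 i - w s 0 i = \int[mu]_(r in `[s, t]) v r 0 i.

(* The last two clauses only serve to make elements with the same class equal:
   a path on I is a function on the line extended by 0 outside of I, and the
   space over a null interval is trivial. *)
Definition sobolev12 I w :=
  [/\ L2fun I w, exists v, weak_derivative I w v,
      forall s, s \notin I -> w s = 0 & mu [set` I] = 0%E -> w = cst 0].

Let mI I : measurable ([set` I] : set (measurableTypeR R)). Proof. exact: measurable_itv. Qed.

Lemma L2fun_lin I a u v : L2fun I u -> L2fun I v -> L2fun I (a *: u + v).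
Proof.
have h12 : (1 <= 2%:E :> \bar R)%E by rewrite lee_fin ler1n.
move=> uI vI i; have [_ h] := Lfun_submod_closed mu h12.
apply: etrans (h a _ _ (uI i) (vI i)); congr in_mem.
apply/funext => s; rewrite !fctE /patch /=.
by case: ifP => _; rewrite ?mxE// scaler0 addr0.
Qed.

Lemma L2fun0 I : L2fun I (cst 0).
Proof.
have h12 : (1 <= 2%:E :> \bar R)%E by rewrite lee_fin ler1n.
move=> i; have [h _] := Lfun_submod_closed mu h12.
apply: etrans h; congr in_mem.
by apply/funext => s; rewrite /patch /= mxE if_same.
Qed.

Lemma L2fun_mul I u v i : L2fun I u -> L2fun I v ->
  mu.-integrable [set` I] (EFin \o (fun s => u s 0 i * v s 0 i)).
Proof.
move=> /(_ i) uI /(_ i) vI; have := Lfun2_mul_Lfun1 uI vI.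
move/Lfun1_integrable => h; apply/integrable_mkcond => //.
rewrite restrict_EFin.
move: h; congr (integrable _ _ (EFin \o _)).
by apply/funext => s; rewrite /patch /=; case: ifP => // _; rewrite mul0r.
Qed.

Lemma L2fun_measurable I v i : L2fun I v ->
  measurable_fun setT ((fun s => v s 0 i) \_ [set` I]).
Proof. by move=> /(_ i) /andP[/set_mem]. Qed.


Lemma L2fun_loc I v i (J : set (measurableTypeR R)) : L2fun I v ->
  measurable J -> (mu J < +oo)%E ->
  mu.-integrable J (EFin \o ((fun s => v s 0 i) \_ [set` I])).
Proof.
move=> vI mJ fJ; set f := _ \_ _.
have h2 : mu.-integrable J (EFin \o (fun s => f s ^+ 2)).
  apply: (integrableS measurableT mJ) => //.
  exact: (Lfun2_integrable_sqr (vI i)).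
have h1 : mu.-integrable J (EFin \o cst (1 : R)).
  apply/integrableP; split; first exact/measurable_EFinP/measurable_cst.
  rewrite (_ : (fun x => `|_|%E) = cst 1%E) ?integral_cst//= ?mul1e//.
  by apply/funext => s /=; rewrite normr1.
apply: (le_integrable mJ _ _ (integrableD mJ h1 h2)).
  apply/measurable_EFinP; apply: (measurable_funS measurableT) => //.
  exact: L2fun_measurable.
move=> s _ /=; rewrite lee_fin [leRHS]ger0_norm; last first.
  by rewrite addr_ge0// sqr_ge0.
have [le1|/ltW ge1] := leP `|f s| 1.
  by rewrite (le_trans le1)// lerDl sqr_ge0.
rewrite -[f s ^+ 2]ger0_norm ?sqr_ge0// normrX.
by rewrite (le_trans (_ : _ <= `|f s| ^+ 2))// ?lerDr// ler_eXnr.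
Qed.

Lemma L2fun_sub I J v i : L2fun I v -> [set` J] `<=` [set` I] ->
  (mu [set` J] < +oo)%E ->
  mu.-integrable [set` J] (EFin \o (fun s => v s 0 i)).
Proof.
move=> vI JI fJ; apply: eq_integrable (L2fun_loc i vI (mI J) fJ) => //.
by move=> s /set_mem Js; rewrite /= /patch mem_set//; exact: JI.
Qed.

Lemma negligible_sub1 (A : set (measurableTypeR R)) :
  (forall x y, A x -> A y -> x = y) -> mu.-negligible A.
Proof.
move=> A1; have [->|/set0P[x Ax]] := eqVneq A set0; first exact: negligible_set0.
apply: (@negligibleS _ _ _ _ [set x]).
  by move=> y Ay; apply: A1.
by exists [set x]; split => //; exact: lebesgue_measure_set1.
Qed.

Lemma ae_itv_inner I : {ae mu, forall x, x \in I ->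
  exists s t, [/\ s \in I, t \in I, s < x & x < t]}.
Proof.
have H1 : {ae mu, forall x, x \in I -> exists2 s, s \in I & s < x}.
  apply: negligible_sub1 => x y /not_implyP[xI xm] /not_implyP[yI ym].
  by apply/eqP; rewrite eq_le; apply/andP; split; rewrite leNgt;
    apply/negP => h; [apply: xm; exists y|apply: ym; exists x].
have H2 : {ae mu, forall x, x \in I -> exists2 t, t \in I & x < t}.
  apply: negligible_sub1 => x y /not_implyP[xI xm] /not_implyP[yI ym].
  by apply/eqP; rewrite eq_le; apply/andP; split; rewrite leNgt;
    apply/negP => h; [apply: ym; exists x|apply: xm; exists y].
apply: filterS2 H1 H2; first exact: (ae_filter_ringOfSetsType mu).
move=> x h1 h2 xI.
by have [s sI sx] := h1 xI; have [u uI xu] := h2 xI; exists s, u.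
Qed.

Lemma L2fun_ae0 I v : L2fun I v ->
  (forall i s t, s \in I -> t \in I -> s <= t ->
    \int[mu]_(r in `[s, t]) v r 0 i = 0) -> v = cst 0 %[ae mu in [set` I]].
Proof.
move=> vI v0.
suff H i : {ae mu, forall x, x \in I -> v x 0 i = 0}.
  have := @filter_forall _ _ (fun i => [set x | x \in I -> v x 0 i = 0]) (almost_everywhere mu) (ae_filter_ringOfSetsType mu) H.
  apply: filterS; first exact: (ae_filter_ringOfSetsType mu).
  move=> x h xI; apply/rowP => i; rewrite mxE; exact: h.
pose f := (fun s => v s 0 i) \_ [set` I].
have locf : locally_integrable setT f.
  split; [exact: L2fun_measurable|exact: openT|].
  move=> K _ cK; have mK := compact_measurable cK.
  by have /integrableP[] := L2fun_loc i vI mK (compact_finite_measure cK).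
apply: filterS2 (lebesgue_differentiation locf) (ae_itv_inner I).
  exact: (ae_filter_ringOfSetsType mu).
move=> x fx inn xI; have [s [u [sI uI sx xu]]] := inn xI.
have ifu : mu.-integrable [set` Interval (BLeft s) (BRight u)] (EFin \o f).
  apply: L2fun_loc => //.
  by have := compact_finite_measure (@segment_compact _ s u).
have [|_ /=] := FTC1_lebesgue_pt xu ifu _ fx; first by rewrite /= lte_fin.
rewrite {2}/f patchE mem_set// => <-.
rewrite derive1E (@near_eq_derive _ _ _ _ (cst 0)) ?derive_cst//.
near=> y; rewrite /=.
have sy : s <= y by apply: ltW; near: y; exact: lt_nbhsr.
have yu : y <= u by apply: ltW; near: y; exact: lt_nbhsl.
have yI : y \in I.
  by apply: (@interval_is_interval _ I s u) => //; rewrite sy.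
rewrite -[RHS](v0 i s y)//; apply: eq_Rintegral => r /set_mem /=.
rewrite in_itv/= => /andP[sr ry]; rewrite /f patchE mem_set//=.
by apply: (@interval_is_interval _ I s u) => //; rewrite sr (le_trans ry).
Unshelve. all: by end_near. Qed.

Lemma weak_derivative_uniq I w v1 v2 : weak_derivative I w v1 ->
  weak_derivative I w v2 -> v1 = v2 %[ae mu in [set` I]].
Proof.
move=> [L1 h1] [L2 h2].
have L3 : L2fun I (- 1 *: v2 + v1) by exact: L2fun_lin.
have : - 1 *: v2 + v1 = cst 0 %[ae mu in [set` I]].
  apply: L2fun_ae0 => // i s t sI tI st.
  have sub : [set` `[s, t]] `<=` [set` I].
    by move=> r /=; rewrite in_itv/=; exact: (@interval_is_interval _ I s t).
  have fin : (mu `[s, t] < +oo)%E.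
    by have := compact_finite_measure (@segment_compact _ s t).
  transitivity (\int[mu]_(r in `[s, t]) (v1 r 0 i - v2 r 0 i)).
    by apply: eq_Rintegral => r _; rewrite !fctE !mxE mulN1r addrC.
  rewrite RintegralB//; [|exact: L2fun_sub sub fin..].
  by rewrite -h1// -h2// subrr.
apply: filterS; first exact: (ae_filter_ringOfSetsType mu).
move=> x /[apply] /=; rewrite !fctE scaleN1r.
by move/eqP; rewrite addrC subr_eq0 => /eqP.
Qed.

Lemma weak_derivative_lin I a w1 w2 v1 v2 : weak_derivative I w1 v1 ->
  weak_derivative I w2 v2 -> weak_derivative I (a *: w1 + w2) (a *: v1 + v2).
Proof.
move=> [L1 h1] [L2 h2]; split; first exact: L2fun_lin.
move=> i s t sI tI st.
have sub : [set` `[s, t]] `<=` [set` I].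
  by move=> r /=; rewrite in_itv/=; exact: (@interval_is_interval _ I s t).
have fin : (mu `[s, t] < +oo)%E.
  by have := compact_finite_measure (@segment_compact _ s t).
transitivity (\int[mu]_(r in `[s, t]) (a * v1 r 0 i + v2 r 0 i)); last first.
  by apply: eq_Rintegral => r _; rewrite !fctE !mxE.
have i1 := L2fun_sub i L1 sub fin; have i2 := L2fun_sub i L2 sub fin.
rewrite RintegralD//; last exact: (integrableZl _ a i1).
rewrite RintegralZl// -h1// -h2// !fctE !mxE mulrBr; ring.
Qed.

Lemma weak_derivative0 I : weak_derivative I (cst 0) (cst 0).
Proof.
split; first exact: L2fun0.
move=> i s t _ _ _; under eq_Rintegral do rewrite mxE.
by rewrite Rintegral_cst// mul0r !mxE subrr.
Qed.

(* A choice of weak derivative, determined a.e. on I by weak_derivative_uniq. *)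
Definition wderiv I w := xget (cst 0) [set v | weak_derivative I w v].

Lemma wderivP I w : (exists v, weak_derivative I w v) ->
  weak_derivative I w (wderiv I w).
Proof. exact: xgetPex. Qed.

Definition sobolev12_pred I : {pred (R -> 'rV[R]_n)} :=
  fun w => `[< sobolev12 I w >].

Lemma sobolev12_submod_closed I : submod_closed (sobolev12_pred I).
Proof.
split.
  apply/asboolP; split => //; first exact: L2fun0.
  by exists (cst 0); exact: weak_derivative0.
move=> a w1 w2 /asboolP[L1 [v1 d1] o1 z1] /asboolP[L2 [v2 d2] o2 z2].
apply/asboolP; split; first exact: L2fun_lin.
- by exists (a *: v1 + v2); exact: weak_derivative_lin.
- by move=> s sI; rewrite !fctE o1// o2// scaler0 addr0.
- by move=> m0; rewrite z1// z2// scaler0 addr0.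
Qed.


Definition L2dot I u v := \int[mu]_(s in [set` I]) \sum_(i < n) u s 0 i * v s 0 i.

Lemma L2norm_sqr I v : L2norm I v ^+ 2 = L2dot I v v.
Proof.
rewrite /L2norm sqr_sqrtr.
  by apply: eq_Rintegral => s _; apply: eq_bigr => i _; rewrite expr2.
by apply: Rintegral_ge0 => s _; apply: sumr_ge0 => i _; rewrite sqr_ge0.
Qed.

Lemma L2dot_integrable I u v : L2fun I u -> L2fun I v ->
  mu.-integrable [set` I] (EFin \o (fun s => \sum_(i < n) u s 0 i * v s 0 i)).
Proof.
move=> uI vI; have := @integrable_sum _ _ _ mu _ (mI I) _ (index_enum 'I_n) xpredT
  (fun i s => (u s 0 i * v s 0 i)%:E) (fun i _ => L2fun_mul i uI vI).
by apply: eq_integrable => // s _; rewrite /= sumEFin.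
Qed.


Lemma L2dot_quad I u v a : L2fun I u -> L2fun I v ->
  L2norm I (a *: u + v) ^+ 2 =
  a ^+ 2 * L2norm I u ^+ 2 + (2 * a * L2dot I u v + L2norm I v ^+ 2).
Proof.
move=> uI vI; rewrite !L2norm_sqr.
have iuu := L2dot_integrable uI uI.
have iuv := L2dot_integrable uI vI.
have ivv := L2dot_integrable vI vI.
have ia b := integrableZl (mI I) b iuu.
have ib b := integrableZl (mI I) b iuv.
have iab := integrableD (mI I) (ib (2 * a)) ivv.
rewrite /L2dot -(RintegralZl _ (mI I) iuu) -(RintegralZl _ (mI I) iuv).
rewrite -(RintegralD (mI I) (ib (2 * a)) ivv) -(RintegralD (mI I) (ia (a ^+ 2)) iab).
apply: eq_Rintegral => s _; rewrite !mulr_sumr -!big_split/=.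
by apply: eq_bigr => i _; rewrite !fctE !mxE; ring.
Qed.

Lemma ae_sub (P Q : R -> Prop) : (forall x, P x -> Q x) ->
  {ae mu, forall x, P x} -> {ae mu, forall x, Q x}.
Proof. by move=> PQ; apply: negligibleS => x nQ /PQ. Qed.

Lemma L2norm_ae I u v : L2fun I u -> L2fun I v ->
  u = v %[ae mu in [set` I]] -> L2norm I u = L2norm I v.
Proof.
move=> uI vI uv; congr Num.sqrt; congr fine.
apply: ae_eq_integral => //.
- have /integrableP[+ _] := L2dot_integrable uI uI.
  by apply: eq_measurable_fun => s _ /=; congr EFin; apply: eq_bigr => i _; rewrite expr2.
- have /integrableP[+ _] := L2dot_integrable vI vI.
  by apply: eq_measurable_fun => s _ /=; congr EFin; apply: eq_bigr => i _; rewrite expr2.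
- by apply: ae_sub uv => s h Is; rewrite /= h.
Qed.

Lemma L2norm_eq0 I v : L2fun I v -> L2norm I v = 0 ->
  v = cst 0 %[ae mu in [set` I]].
Proof.
move=> vI v0; have iv := L2dot_integrable vI vI.
have : L2dot I v v = 0 by rewrite -L2norm_sqr v0 expr0n.
rewrite /L2dot /Rintegral => /eqP; rewrite fine_eq0; last first.
  exact: integrable_fin_num iv.
move=> /eqP h.
have := (ae_eq_integral_abs mu (mI I) (measurable_int _ iv)).1.
have /[swap]/[apply] : (\int[mu]_(x in [set` I]) `|(EFin \o
   (fun s => (\sum_(i < n) v s 0 i * v s 0 i)%R)) x| = 0)%E.
  rewrite -[RHS]h; apply: eq_integral => s _ /=; rewrite ger0_norm//.
  by apply: sumr_ge0 => i _; rewrite -expr2 sqr_ge0.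
apply: ae_sub => s /[apply] /= -[] /eqP; rewrite psumr_eq0; last first.
  by move=> i _; rewrite -expr2 sqr_ge0.
move=> /allP /= h0; apply/rowP => i; rewrite mxE.
by have := h0 i (mem_index_enum i); rewrite mulf_eq0 orbb => /eqP.
Qed.

End sobolev.

Section W12.
Context {R : realType} (n : nat) (I : interval R).
Local Notation mu := (@lebesgue_measure R).

Record W12 := MkW12 {
  W12_fun :> R -> 'rV[R]_n ;
  _ : W12_fun \in sobolev12_pred I }.

HB.instance Definition _ := [isSub for W12_fun].
HB.instance Definition _ := [Choice of W12 by <:].
HB.instance Definition _ := GRing.isSubmodClosed.Build _ _
  (@sobolev12_pred R n I) (sobolev12_submod_closed I).
HB.instance Definition _ := [SubChoice_isSubLmodule of W12 by <:].

Definition W12_norm (w : W12) :=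
  Num.sqrt (L2norm I w ^+ 2 + L2norm I (wderiv I w) ^+ 2).

Lemma W12P (w : W12) : sobolev12 I w.
Proof. by case: w => f /= /asboolP. Qed.

Lemma W12_L2 (w : W12) : L2fun I w.
Proof. by have [] := W12P w. Qed.

Lemma W12_wderivP (w : W12) : weak_derivative I w (wderiv I w).
Proof. by have [_ h _ _] := W12P w; exact: wderivP. Qed.

Lemma W12_linE a (u v : W12) :
  W12_fun (a *: u + v) = a *: W12_fun u + W12_fun v.
Proof. by []. Qed.

Lemma W12_norm_sqr w :
  W12_norm w ^+ 2 = L2norm I w ^+ 2 + L2norm I (wderiv I w) ^+ 2.
Proof. by rewrite sqr_sqrtr// addr_ge0// sqr_ge0. Qed.

Lemma W12_quad (u v : W12) : exists B, forall a : R,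
  W12_norm (a *: u + v) ^+ 2 = a ^+ 2 * W12_norm u ^+ 2 + (2 * a * B + W12_norm v ^+ 2).
Proof.
exists (L2dot I u v + L2dot I (wderiv I u) (wderiv I v)) => a.
have hd := weak_derivative_lin a (W12_wderivP u) (W12_wderivP v).
have hw := W12_wderivP (a *: u + v).
have E1 := L2norm_ae hw.1 hd.1 (weak_derivative_uniq hw hd).
have E2 := L2dot_quad a (W12_wderivP u).1 (W12_wderivP v).1.
have E3 := L2dot_quad a (W12_L2 u) (W12_L2 v).
apply: (etrans (W12_norm_sqr _)).
apply: (etrans (congr2 +%R E3 (etrans (congr1 (fun x => x ^+ 2) E1) E2))).
apply: esym; apply: (etrans (congr2
  (fun p q => a ^+ 2 * p + (2 * a * _ + q)) (W12_norm_sqr u) (W12_norm_sqr v))).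
move: (L2dot _ _ _) (L2dot _ _ _) => x y.
move: (L2norm _ _) (L2norm _ _) (L2norm _ _) (L2norm _ _) => p q r t.
ring.
Qed.

Lemma W12_norm_ge0 w : 0 <= W12_norm w. Proof. exact: sqrtr_ge0. Qed.

Lemma W12_normD (u v : W12) : W12_norm (u + v) <= W12_norm u + W12_norm v.
Proof.
have [B hB] := W12_quad u v.
have p0 := W12_norm_ge0 u; have q0 := W12_norm_ge0 v.
have := hB 1; rewrite scale1r expr1n mul1r mulr1 => h1.
move: (W12_norm (u + v)) (W12_norm_ge0 (u + v)) h1 => r r0 h1.
have pos a : 0 <= a ^+ 2 * W12_norm u ^+ 2 + (2 * a * B + W12_norm v ^+ 2).
  by rewrite -hB sqr_ge0.
move: (W12_norm u) (W12_norm v) p0 q0 h1 pos {hB} => p q p0 q0 h1 pos.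
suff pq : B <= p * q.
  rewrite -(@ler_pXn2r _ 2)// ?nnegrE ?addr_ge0// h1; nra.
have [B0|B0] := leP B 0; first by rewrite (le_trans B0)// mulr_ge0.
have [pE|p0'] := eqVneq p 0.
  have := pos (- (q ^+ 2 + 1) / (2 * B)).
  rewrite pE expr0n mulr0 add0r (_ : 2 * _ * B = - (q ^+ 2 + 1)); last first.
    by field; rewrite gt_eqF.
  lra.
rewrite -(@ler_pXn2r _ 2)// ?nnegrE ?mulr_ge0 ?(ltW B0)//.
have := pos (- B / p ^+ 2).
have -> : (- B / p ^+ 2) ^+ 2 * p ^+ 2 + (2 * (- B / p ^+ 2) * B + q ^+ 2) =
  (p ^+ 2 * q ^+ 2 - B ^+ 2) / p ^+ 2 by field.
rewrite pmulr_lge0 ?invr_gt0 ?exprn_gt0 ?lt_def ?p0'//.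
by rewrite subr_ge0 exprMn.
Qed.

Lemma W12_norm0 : W12_norm 0 = 0.
Proof.
have [B hB] := W12_quad 0 0; have := hB 1; have := hB (-1).
rewrite !scaler0 !addr0 => h1 h2; apply/eqP; rewrite -sqrf_eq0; apply/eqP.
lra.
Qed.

Lemma W12_normZ a (u : W12) : W12_norm (a *: u) = `|a| * W12_norm u.
Proof.
have [B hB] := W12_quad u 0.
have h b : W12_norm (b *: u) ^+ 2 = b ^+ 2 * W12_norm u ^+ 2 + 2 * b * B.
  by have := hB b; rewrite addr0 W12_norm0 expr0n addr0.
have B0 : B = 0.
  have := h 1; rewrite scale1r; lra.
apply/eqP; rewrite -(@eqrXn2 _ 2)// ?mulr_ge0 ?W12_norm_ge0//.
by rewrite h B0 mulr0 addr0 exprMn real_normK// num_real.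
Qed.

Lemma W12_normr0_eq0 (w : W12) : W12_norm w = 0 -> w = 0.
Proof.
move=> w0; have := W12_norm_sqr w; rewrite w0 expr0n => /esym/eqP.
rewrite paddr_eq0 ?sqr_ge0// !sqrf_eq0 => /andP[/eqP n0 /eqP d0].
have [Ld hd] := W12_wderivP w.
have := L2norm_eq0 (W12_L2 w) n0; have := L2norm_eq0 Ld d0 => ad aw.
have [_ _ wo wn] := W12P w.
apply/val_inj => /=; have [m0|m0] := eqVneq (mu [set` I]) 0%E; first exact: wn.
have cst_le s t : s \in I -> t \in I -> s <= t -> w t = w s.
  move=> sI tI st; apply/rowP => i; apply/eqP; rewrite -subr_eq0 hd//.
  have sub : [set` `[s, t]] `<=` [set` I].
    by move=> r /=; rewrite in_itv/=; exact: (@interval_is_interval _ I s t).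
  have fin : (mu `[s, t] < +oo)%E.
    by have := compact_finite_measure (@segment_compact _ s t).
  have /measurable_int mh := L2fun_sub i Ld sub fin.
  rewrite /Rintegral (ae_eq_integral (cst 0%E))//.
    by rewrite integral0 eqxx.
  by apply: ae_sub ad => r h rst; rewrite /= h ?mxE//; exact: sub.
have wc s t : s \in I -> t \in I -> w t = w s.
  move=> sI tI; have [st|/ltW ts] := leP s t; first exact: cst_le.
  by rewrite (cst_le t s).
have [s0 s0I ws0] : exists2 s, s \in I & w s = 0.
  apply: contrapT => nex; case/eqP: m0; case: aw => N [mN N0 IN].
  apply/eqP; rewrite eq_le measure_ge0 andbT -N0.
  have mI : measurable ([set` I] : set (measurableTypeR R)) by exact: measurable_itv.
  apply: (le_measure mu (mem_set mI) (mem_set mN)).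
  by move=> s sI; apply: (IN s) => /= h; apply: nex; exists s => //; exact: h.
apply/funext => s; have [sI|sI] := boolP (s \in I); last by rewrite wo.
by rewrite (wc s0 s).
Qed.

HB.instance Definition _ := Lmodule_isNormed.Build R W12
  W12_normD W12_normZ W12_normr0_eq0.

End W12.


Lemma W12_normE (R : realType) n (I : interval R) (w : W12 n I) :
  `|w| = Num.sqrt (L2norm I w ^+ 2 + L2norm I (wderiv I w) ^+ 2).
Proof. by []. Qed.

Notation Wplus R n := (@W12 R n `[0, +oo[).
Notation Wminus R n := (@W12 R n `]-oo, 0]).
Notation WT n T := (@W12 _ n `[- T, T]).

Unset Implicit Arguments.

Definition flowop {R : realType} {n : nat} (X : 'rV[R]_n -> 'rV[R]_n)
    {I : interval R} (w : W12 n I) : R -> 'rV[R]_n :=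
  fun s => wderiv I w s + X (w s).

(* For X = grad f these are W^s, W^u and M_T, for X = A the tangent spaces E^+,
   E^- and E_T at the constant path 0. *)
Definition solutions {R : realType} {n : nat} (X : 'rV[R]_n -> 'rV[R]_n)
    (I : interval R) : set (W12 n I) :=
  [set w | flowop X w = cst 0 %[ae (@lebesgue_measure R) in [set` I]]].

Definition linfield {R : realType} {n : nat} (a : 'rV[R]_n) (x : 'rV[R]_n) :
    'rV[R]_n :=
  x *m diag_mx a.

Definition KT {R : realType} {n : nat} (k : nat) (T : R) : set (WT n T) :=
  [set z : WT n T |
    forall i : 'I_n, if (i < n - k)%N then z (- T) 0 i = 0 else z T 0 i = 0].

(* W_T is the direct sum of E_T and K_T, and D_T maps K_T bijectively onto L^2:
   the sets chosen from in PiT and, for v in L^2, in QT are singletons. *)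
Definition PiT {R : realType} {n : nat} (k : nat) (T : R) (a : 'rV[R]_n)
    (w : WT n T) : WT n T :=
  xget 0 [set e : WT n T | solutions (linfield a) `[- T, T] e /\ KT k T (w - e)].

Definition QT {R : realType} {n : nat} (k : nat) (T : R) (a : 'rV[R]_n)
    (v : R -> 'rV[R]_n) : WT n T :=
  xget 0 [set z : WT n T | KT k T z /\
    flowop (linfield a) z = v %[ae (@lebesgue_measure R) in [set` `[- T, T]]]].

(* The formula defines an element of W_T when beta is smooth, so that the default
   value of insubd is not used. *)
Definition preglue {R : realType} {n : nat} (T : R) (beta : R -> R)
    (w : Wplus R n * Wminus R n) : WT n T :=
  insubd 0 (fun s => if s \in `[- T, T]
                     then (1 - beta (s + 2)) *: w.1 (T + s)
                          + beta (s - 2) *: w.2 (- T + s)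
                     else 0).

(* The differential at (0, 0) of the restriction of P_T to W^s x W^u is the
   restriction to E^+ x E^- of the differential of P_T. *)
Definition Gamma {R : realType} {n : nat} (k : nat) (T : R) (a : 'rV[R]_n)
    (beta : R -> R) (w : Wplus R n * Wminus R n) : WT n T :=
  PiT k T a ('d (preglue T beta) (0, 0) w).

Definition newton_picard_domain {R : realType} {n : nat} (T : R)
    (X : 'rV[R]_n -> 'rV[R]_n) (c delta : R) : set (WT n T) :=
  [set w : WT n T | `|w| < delta / 8 /\
                    L2norm `[- T, T] (flowop X w) < delta / (4 * c)].

Definition newton_picard_map {R : realType} {n : nat} (k : nat) (T : R)
    (X : 'rV[R]_n -> 'rV[R]_n) (c delta : R) (N : WT n T -> WT n T) : Prop :=
  forall w, newton_picard_domain T X c delta w ->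
    unique (fun z => [/\ solutions X `[- T, T] z, KT k T (z - w) & `|z| < delta])
           (N w).

(* Main.v *)
From HB Require Import structures.
Require Import Defs.
From mathcomp Require Import all_boot all_order all_algebra.
From mathcomp Require Import all_classical all_reals all_analysis.
From mathcomp Require Import measurable_realfun ring lra.
Import Order.TTheory GRing.Theory Num.Theory.
Import numFieldNormedType.Exports.
Local Open Scope classical_set_scope.
Local Open Scope ring_scope.
Set Implicit Arguments. Unset Strict Implicit. Unset Printing Implicit Defensive.

(**
Write X for the gradient field, A for its linearization at 0, and consider a
pair w of a stable and an unstable solution with pregluing u. The glued path z
solves the equation of the flow of X and satisfies z - u in K_T; along the
tangent spaces the expected answer is e = Pi_T u, which solves the linearized
equation and satisfies u - e in K_T. So the error k = z - e lies in K_T, where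
the linearized operator D_T is inverted by Q_T, and
  D_T k = D_T z = A z - X(z),
which gives |k| <= c |X(z) - A z| in L^2 [newton_picard_close]. This is used
twice.
 - The closeness of the derivative of X to A on the delta-ball and the mean
   value inequality give |X(z) - A z| <= |z| / (4 c), so |k| <= |z| / 4 and
   |z| <= 2 |Pi_T u| [newton_picard_norm_le]: the glued path tends to 0 with w.
 - As X is differentiable at 0 with derivative A, and as the W^{1,2} norm
   bounds the sup norm on [-T, T], |X(z) - A z| is o(|z|), so
   |k| = o(|Pi_T u|) = o(|w|) [newton_picard_first_order].
Hence the bounded linear map Pi_T o P_T approximates the gluing map to first
order at the pair of constant paths. The estimate holds on the product of the
two solution neighbourhoods; extending the gluing map by Pi_T o P_T to all other
pairs of paths gives a map on the ambient space that is Frechet differentiable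
at 0, with differential Pi_T o P_T. The Newton-Picard map enters this argument
through the properties that characterize its values.

What makes this work on the path spaces is:
 - the product rule for W^{1,2} paths [weak_derivative_mul], which makes P_T a
   bounded linear map [preglue_linear, preglue_bounded], and which shows that
   E_T and K_T meet in 0 only [linear_flow_eq0];
 - the explicit exponential solutions, which show that E_T and K_T span the
   space of paths [linear_flow_exists];
 - the bound on Q_T, which gives that of Pi_T, because u - Pi_T u is Q_T of
   D_T u [PiT_bounded];
 - the identification of the derivative of X at 0 with A, where the critical
   point kills the contribution of the derivative of the metric
   [diff_gradient0].
*)

(** * Lebesgue integration on the line *)

Section translation.
Context {R : realType}.
Local Notation mu := (@lebesgue_measure R).

Lemma measurable_translation (h : R) :
  measurable_fun [set: measurableTypeR R] (fun s : measurableTypeR R => h + s : measurableTypeR R).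
Proof. by apply: measurable_funD => //; exact: measurable_cst. Qed.

(** Half-open intervals generate the Borel sets and determine Lebesgue measure,
    so translation invariance needs to be checked on them only. *)
Lemma lebesgue_measure_itv_translation (h : R) (X : set R) : ocitv X ->
   mu X = pushforward mu (fun s => h + s) X.
Proof.
move=> /ocitvP[->|[[x y] /= xy ->]].
  by rewrite /pushforward preimage_set0 !measure0.
rewrite /pushforward (_ : _ @^-1` _ = `]x - h, y - h]%classic).
  rewrite !lebesgue_measure_itv/= !lte_fin xy ltrBlDr subrK xy -!EFinB; congr EFin; ring.
by apply/seteqP; split => s /=; rewrite !in_itv/= ltrBlDr lerBrDr addrC.
Qed.

Lemma lebesgue_measure_translation (h : R) (A : set (measurableTypeR R)) : measurable A ->
  pushforward mu (fun s : measurableTypeR R => h + s : measurableTypeR R) A = mu A.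
Proof.
move=> mA; pose nu : {measure set (measurableTypeR R) -> \bar R} :=
  measure_function_pushforward__canonical__measure_function_Measure mu (measurable_translation h).
by apply/esym/(lebesgue_measure_unique (mu := nu) _ mA) => X; exact: lebesgue_measure_itv_translation.
Qed.

Lemma ge0_integral_translation (h : R) (f : R -> \bar R) :
  measurable_fun [set: measurableTypeR R] f -> (forall s, 0 <= f s)%E ->
  (\int[mu]_s f (h + s)%R = \int[mu]_s f s)%E.
Proof.
move=> mf f0.
have := @ge0_integral_pushforward _ _ _ _ _ _ (@measurable_translation h) mu setT (f : measurableTypeR R -> _) measurableT mf (fun s _ => f0 s).
rewrite preimage_setT => <-.
apply: eq_measure_integral; first exact: measurable_translation.
by move=> ? A mA _; exact: lebesgue_measure_translation.
Qed.

Lemma integral_translation (h : R) (f : R -> \bar R) :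
  measurable_fun [set: measurableTypeR R] f ->
  (\int[mu]_s f (h + s)%R = \int[mu]_s f s)%E.
Proof.
move=> mf; rewrite integralE [RHS]integralE; congr (_ - _)%E.
  apply: etrans (ge0_integral_translation h (measurable_funepos mf) _).
    by apply: eq_integral => s _; exact: (congr1 (fun g => g s) (funepos_comp f (fun s => h + s))).
  by move=> s; exact: funepos_ge0.
apply: etrans (ge0_integral_translation h (measurable_funeneg mf) _).
  by apply: eq_integral => s _; exact: (congr1 (fun g => g s) (funeneg_comp f (fun s => h + s))).
by move=> s; exact: funeneg_ge0.
Qed.

End translation.

Section product_rule.
Context {R : realType}.
Local Notation mu := (@lebesgue_measure R).

Lemma itv_cc_sub (a b s t : R) : a <= s -> t <= b -> `[s, t]%classic `<=` `[a, b]%classic.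
Proof. by move=> as_ tb r /=; rewrite !in_itv/= => /andP[sr rt]; rewrite (le_trans as_)// (le_trans rt). Qed.

Lemma integrable_sub (a b s t : R) (f : R -> R) : a <= s -> t <= b ->
  mu.-integrable `[a, b] (EFin \o f) -> mu.-integrable `[s, t] (EFin \o f).
Proof. by move=> as_ tb; apply: integrableS => //; exact: itv_cc_sub. Qed.

Lemma Rintegral_cst_itv (a b r : R) : a <= b -> \int[mu]_(s in `[a, b]) r = r * (b - a).
Proof.
move=> ab; rewrite Rintegral_cst//; congr (_ * _).
change (fine (mu `[a, b]%classic) = b - a).
rewrite lebesgue_measure_itv/= lte_fin; case: ltP => [_//|ba].
by rewrite (_ : a = b) ?subrr//; apply/eqP; rewrite eq_le ab.
Qed.

Lemma Rintegral_chasles (a b c : R) (f : R -> R) : a <= b -> b <= c ->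
  mu.-integrable `[a, c] (EFin \o f) ->
  \int[mu]_(r in `[a, c]) f r = \int[mu]_(r in `[a, b]) f r + \int[mu]_(r in `[b, c]) f r.
Proof.
move=> ab bc fi; apply/eqP; rewrite addrC -subr_eq; apply/eqP.
rewrite Rintegral_itvB ?bnd_simp// Rintegral_itv_obnd_cbnd//.
by apply: integrableS fi => //; apply: subset_itvr; rewrite bnd_simp.
Qed.

(** Halving an interval halves the bound: each piece has half the length, and the
    contributions of V add up to V s t again. So G a b is at most
    K (b - a) V a b / 2 ^ N for every N. This is how an identity between interval
    functions follows from a second-order estimate, without differentiation. *)
Lemma additive_superlinear_eq0 (a b K : R) (G V : R -> R -> R) : a <= b ->
  (forall s m t, a <= s -> s <= m -> m <= t -> t <= b -> G s t = G s m + G m t) ->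
  (forall s m t, a <= s -> s <= m -> m <= t -> t <= b -> V s t = V s m + V m t) ->
  (forall s t, a <= s -> s <= t -> t <= b -> `|G s t| <= K * (t - s) * V s t) ->
  G a b = 0.
Proof.
move=> ab GD VD GV.
have H N : forall s t, a <= s -> s <= t -> t <= b ->
    `|G s t| * 2 ^+ N <= K * (t - s) * V s t.
  elim: N => [|N IH] s t as_ st tb; first by rewrite expr0 mulr1; exact: GV.
  pose m := (s + t) / 2.
  have sm : s <= m by rewrite /m; lra.
  have mt : m <= t by rewrite /m; lra.
  have h1 := IH s m as_ sm (le_trans mt tb).
  have h2 := IH m t (le_trans as_ sm) mt tb.
  rewrite (GD s m t)// (VD s m t)// exprS.
  apply: (@le_trans _ _ (2 * ((`|G s m| + `|G m t|) * 2 ^+ N))).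
    by rewrite mulrCA ler_pM2l// ler_pM2r ?exprn_gt0// ler_normD.
  have -> : K * (t - s) * (V s m + V m t) =
    2 * (K * (m - s) * V s m + K * (t - m) * V m t) by rewrite /m; field.
  by rewrite ler_pM2l// mulrDl lerD.
apply/eqP; rewrite -normr_eq0; apply: contraT => G0.
have {}G0 : 0 < `|G a b| by rewrite lt_def G0 normr_ge0.
pose c := K * (b - a) * V a b.
have := H (Num.bound (c / `|G a b|)) a b (lexx _) ab (lexx _).
rewrite -/c mulrC -ler_pdivlMr// leNgt upper_nthrootP//.
Qed.

Lemma continuous_bounded_itv (a b : R) (f : R -> R) : continuous f ->
  exists2 L : R, 0 <= L & forall s, a <= s -> s <= b -> `|f s| <= L.
Proof.
move=> cf; have [ab|ba] := leP a b; last first.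
  by exists 0 => // s as_ sb; have := le_lt_trans (le_trans as_ sb) ba; rewrite ltxx.
have cnf : continuous (fun s => `|f s|).
  by move=> s; apply: (@continuous_comp _ _ _ f (@Num.norm R R)); [exact: cf|exact: norm_continuous].
have [c _ hc] := EVT_max ab (continuous_subspaceT cnf).
by exists `|f c| => // s as_ sb; apply: hc; rewrite in_itv/= as_.
Qed.

Lemma continuous_measurable_itv (a b : R) (f : R -> R) : continuous f ->
  measurable_fun (`[a, b]%classic : set (measurableTypeR R)) f.
Proof. by move=> cf; apply: measurable_funTS; exact: continuous_measurable_fun. Qed.

Lemma integrable_mul_continuous (a b : R) (f g : R -> R) : continuous f ->
  mu.-integrable `[a, b] (EFin \o g) ->
  mu.-integrable `[a, b] (EFin \o (fun s => f s * g s)).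
Proof.
move=> cf gi; have [L L0 fL] := continuous_bounded_itv a b cf.
have mab : measurable (`[a, b]%classic : set (measurableTypeR R)) by [].
apply: (le_integrable mab _ _ (integrableZl mab L gi)).
  apply/measurable_EFinP; apply: measurable_funM; first exact: continuous_measurable_itv.
  by apply/measurable_EFinP; exact: (measurable_int _ gi).
move=> s /=; rewrite in_itv/= => /andP[as_ sb].
by rewrite lee_fin !normrM [`|L|]ger0_norm// ler_wpM2r// fL.
Qed.

Lemma integrable_continuous (a b : R) (f : R -> R) : continuous f ->
  mu.-integrable `[a, b] (EFin \o f).
Proof.
move=> cf; apply: continuous_compact_integrable; first exact: segment_compact.
exact: continuous_subspaceT.
Qed.

Lemma is_derive_continuous (phi psi : R -> R) :
  (forall x : R, is_derive x 1 phi (psi x)) -> continuous phi.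
Proof.
move=> dphi x; apply: differentiable_continuous; apply/derivable1_diffP.
by case: (dphi x).
Qed.

Lemma Rintegral_derivative (a b : R) (phi psi : R -> R) : a <= b ->
  (forall x : R, is_derive x 1 phi (psi x)) -> continuous psi ->
  \int[mu]_(r in `[a, b]) psi r = phi b - phi a.
Proof.
move=> ab dphi cpsi; have [->|] := eqVneq a b.
  by rewrite set_itv1 Rintegral_set1 subrr.
move=> nab; have {nab}ab : a < b by rewrite lt_def eq_sym nab.
have cphi := is_derive_continuous dphi.
rewrite /Rintegral (@continuous_FTC2 _ psi phi _ _ ab (continuous_subspaceT cpsi))//.
- split; [by move=> x _; case: (dphi x)|exact/cvg_at_right_filter/cphi|exact/cvg_at_left_filter/cphi].
- by move=> x _; rewrite derive1E; exact: derive_val.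
Qed.

Lemma is_derive_lipschitz (a b L : R) (phi psi : R -> R) :
  (forall x : R, is_derive x 1 phi (psi x)) ->
  (forall s, a <= s -> s <= b -> `|psi s| <= L) ->
  forall s t, a <= s -> s <= t -> t <= b -> `|phi t - phi s| <= L * (t - s).
Proof.
move=> dphi psiL s t as_ st tb.
have cphi := is_derive_continuous dphi.
have [c] := MVT_segment st (fun x _ => dphi x) (continuous_subspaceT cphi).
rewrite in_itv/= => /andP[sc ct] ->; rewrite normrM [`|t - s|]ger0_norm ?subr_ge0//.
by apply: ler_wpM2r; rewrite ?subr_ge0// psiL// (le_trans as_, le_trans ct).
Qed.

(** The integral form of the product rule for an absolutely continuous w and a C^1
    factor phi. Over a short interval [s, t], freezing w at s and phi at t in the
    integrand makes the identity exact, and costs an error of at most twice the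
    Lipschitz constant of phi times t - s times the L^1 norm of v; such an error
    vanishes under subdivision. *)
Lemma integral_product_rule (a b : R) (phi psi w v : R -> R) : a <= b ->
  (forall x : R, is_derive x 1 phi (psi x)) -> continuous psi ->
  mu.-integrable `[a, b] (EFin \o v) -> mu.-integrable `[a, b] (EFin \o w) ->
  (forall s t, a <= s -> s <= t -> t <= b ->
     w t - w s = \int[mu]_(r in `[s, t]) v r) ->
  phi b * w b - phi a * w a = \int[mu]_(r in `[a, b]) (psi r * w r + phi r * v r).
Proof.
move=> ab dphi cpsi iv iw hw.
have cphi := is_derive_continuous dphi.
have [L L0 psiL] := continuous_bounded_itv a b cpsi.
have phiL := is_derive_lipschitz dphi psiL.
have ipw := integrable_mul_continuous cpsi iw.
have ipv := integrable_mul_continuous cphi iv.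
have iF : mu.-integrable `[a, b] (EFin \o (fun r => psi r * w r + phi r * v r)).
  by apply: (integrableD _ ipw ipv).
have iV : mu.-integrable `[a, b] (EFin \o (fun r => `|v r|)) by exact: integrable_norm.
pose V s t := \int[mu]_(r in `[s, t]) `|v r|.
pose G s t := phi t * w t - phi s * w s - \int[mu]_(r in `[s, t]) (psi r * w r + phi r * v r).
suff : G a b = 0 by move/eqP; rewrite subr_eq0 => /eqP.
apply: (@additive_superlinear_eq0 a b (2 * L) G V ab).
- move=> s m t as_ sm mt tb; rewrite /G (@Rintegral_chasles s m t)//; first by ring.
  exact: integrable_sub iF.
- move=> s m t as_ sm mt tb; apply: (@Rintegral_chasles s m t) => //.
  exact: integrable_sub iV.
move=> s t as_ st tb.
have mst : measurable (`[s, t]%classic : set (measurableTypeR R)) by [].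
have wV r : s <= r -> r <= t -> `|w r - w s| <= V s t.
  move=> sr rt; rewrite hw//; last exact: le_trans tb.
  apply: (le_trans (le_normr_Rintegral _ _)) => //.
    by apply: integrable_sub iv => //; exact: le_trans tb.
  rewrite /V (Rintegral_chasles sr rt); last exact: integrable_sub iV.
  by rewrite lerDl; apply: Rintegral_ge0.
have iw' : mu.-integrable `[s, t] (EFin \o w) by exact: integrable_sub iw.
have iv' : mu.-integrable `[s, t] (EFin \o v) by exact: integrable_sub iv.
have i1 := integrable_continuous s t cpsi.
have i2 : mu.-integrable `[s, t] (EFin \o (fun r => w s * psi r)) := integrableZl mst (w s) i1.
have i3 : mu.-integrable `[s, t] (EFin \o (fun r => phi t * v r)) := integrableZl mst (phi t) iv'.
have i23 : mu.-integrable `[s, t] (EFin \o (fun r => w s * psi r + phi t * v r)) := integrableD mst i2 i3.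
have iF' : mu.-integrable `[s, t] (EFin \o (fun r => psi r * w r + phi r * v r)).
  exact: integrable_sub iF.
(* The first summand of the integrand is the one with w and phi frozen. *)
have -> : G s t = \int[mu]_(r in `[s, t])
    ((w s * psi r + phi t * v r) - (psi r * w r + phi r * v r)).
  rewrite RintegralB// RintegralD// !RintegralZl//.
  by rewrite (Rintegral_derivative st dphi cpsi) -hw// /G; ring.
have iD : mu.-integrable `[s, t] (EFin \o (fun r =>
  ((w s * psi r + phi t * v r) - (psi r * w r + phi r * v r)))) := integrableB mst i23 iF'.
have iV' : mu.-integrable `[s, t] (EFin \o (fun r => `|v r|)) by exact: integrable_sub iV.
have iV'' : mu.-integrable `[s, t] (EFin \o (fun r => (L * (t - s)) * `|v r|)) := integrableZl mst _ iV'.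
have ic : mu.-integrable `[s, t] (EFin \o (cst (L * V s t) : R -> R)).
  by apply: integrable_continuous => ?; exact: cvg_cst.
apply: (le_trans (le_normr_Rintegral _ _)) => //.
apply: (@le_trans _ _ (\int[mu]_(r in `[s, t]) (L * V s t + (L * (t - s)) * `|v r|))).
  apply: le_Rintegral => //.
  - exact: integrable_norm.
  - exact: (integrableD mst ic iV'').
  move=> r /=; rewrite in_itv/= => /andP[sr rt].
  have -> : w s * psi r + phi t * v r - (psi r * w r + phi r * v r) =
    psi r * - (w r - w s) + (phi t - phi r) * v r by ring.
  apply: (le_trans (ler_normD _ _)); rewrite !normrM normrN; apply: lerD.
    by apply: ler_pM => //; [apply: psiL; lra|exact: wV].
  apply: ler_wpM2r => //; apply: (le_trans (phiL r t _ _ _)) => //; first lra.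
  by apply: ler_wpM2l => //; lra.
rewrite (RintegralD mst ic iV'') (RintegralZl _ mst iV') Rintegral_cst_itv//.
by rewrite le_eqVlt; apply/orP; left; apply/eqP; rewrite -/(V s t); ring.
Qed.

End product_rule.

(** * Square integrable paths *)

Section L2.
Context {R : realType} {n : nat}.
Implicit Types (I J : interval R) (u v w : R -> 'rV[R]_n).
Local Notation mu := (@lebesgue_measure R).

(** The L^2 norm is defined with real powers; this turns its integrand into an
    ordinary square. *)
Lemma Lfun2_of_integrable_sqr (f : measurableTypeR R -> R) :
  measurable_fun setT f -> mu.-integrable setT (EFin \o (fun s => f s ^+ 2)) ->
  f \in Lfun mu 2%:E.
Proof.
move=> mf /integrableP[_ fi]; rewrite inE; apply/andP; split; rewrite inE//=.
rewrite /finite_norm unlock/=.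
apply: poweR_lty; apply: le_lt_trans fi.
rewrite le_eqVlt; apply/orP; left; apply/eqP/eq_integral => s _ /=.
by rewrite normrX powR_mulrn.
Qed.

Let mI I : measurable ([set` I] : set (measurableTypeR R)). Proof. exact: measurable_itv. Qed.

Lemma L2funP I v : L2fun I v <-> forall i,
  measurable_fun ([set` I] : set (measurableTypeR R)) (fun s => v s 0 i) /\
  mu.-integrable [set` I] (EFin \o (fun s => v s 0 i ^+ 2)).
Proof.
split=> [vI i|h i].
  split; first by apply/(measurable_restrictT _ (mI I)); exact: L2fun_measurable.
  by have := L2fun_mul i vI vI; congr (integrable _ _ (_ \o _)); apply/funext => s; rewrite expr2.
have [mv iv] := h i; apply: Lfun2_of_integrable_sqr.
  by apply/(measurable_restrictT _ (mI I)).
move/(integrable_mkcond _ (mI I)) : iv; congr (integrable _ _ _).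
apply/funext => s; rewrite restrict_EFin/= /patch; case: ifP => //=.
by rewrite expr0n.
Qed.

Lemma L2fun_measurable_on I v i : L2fun I v ->
  measurable_fun ([set` I] : set (measurableTypeR R)) (fun s => v s 0 i).
Proof. by move/L2funP => /(_ i)[]. Qed.

Lemma L2fun_sum_sqr I v : L2fun I v ->
  mu.-integrable [set` I] (EFin \o (fun s => \sum_(i < n) v s 0 i ^+ 2)).
Proof.
move=> vI; exact: (L2dot_integrable vI vI).
Qed.

Lemma L2fun_dominated I u v (M : R) : L2fun I v ->
  (forall i, measurable_fun ([set` I] : set (measurableTypeR R)) (fun s => u s 0 i)) ->
  (forall s i, s \in I -> `|u s 0 i| <= M * `|v s 0 i|) -> L2fun I u.
Proof.
move=> vI mu_ uv; apply/L2funP => i; split=> //.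
have iv : mu.-integrable [set` I] (EFin \o (fun s => M ^+ 2 * v s 0 i ^+ 2)).
  have /L2funP/(_ i)[_ h] := vI.
  exact: (integrableZl (mI I) (M ^+ 2) h).
apply: (le_integrable (mI I) _ _ iv).
  by apply/measurable_EFinP/measurable_funX.
move=> s sI /=; rewrite lee_fin [leLHS]ger0_norm ?sqr_ge0// [leRHS]ger0_norm ?(mulr_ge0 (sqr_ge0 _) (sqr_ge0 _))//.
have h := uv s i sI; have h0 := le_trans (normr_ge0 _) h.
have : `|u s 0 i| ^+ 2 <= (M * `|v s 0 i|) ^+ 2 by rewrite lerXn2r ?nnegrE.
by rewrite exprMn !real_normK ?num_real.
Qed.

Lemma L2norm_ge0 I v : 0 <= L2norm I v. Proof. exact: sqrtr_ge0. Qed.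

Lemma L2norm_le_ae I u v (M : R) : 0 <= M -> L2fun I u -> L2fun I v ->
  {ae mu, forall s, s \in I ->
    \sum_(i < n) u s 0 i ^+ 2 <= M ^+ 2 * \sum_(i < n) v s 0 i ^+ 2} ->
  L2norm I u <= M * L2norm I v.
Proof.
move=> M0 uI vI uv.
rewrite -(@ler_pXn2r _ 2) ?nnegrE ?mulr_ge0 ?L2norm_ge0//.
have pos (x : 'rV[R]_n) : 0 <= \sum_(i < n) x 0 i ^+ 2 :> R by move=> *; apply: sumr_ge0 => i _; rewrite sqr_ge0.
have iu := L2fun_sum_sqr uI; have iv := L2fun_sum_sqr vI.
have iMv := integrableZl (mI I) (M ^+ 2) iv.
rewrite exprMn /L2norm !sqr_sqrtr; try by apply: Rintegral_ge0.
rewrite -(RintegralZl _ (mI I) iv); apply: fine_le.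
- exact: (integrable_fin_num (mI I) iu).
- exact: (integrable_fin_num (mI I) iMv).
apply: ae_ge0_le_integral => //.
- by move=> s _; rewrite lee_fin.
- exact: (measurable_int _ iu).
- by move=> s _; rewrite lee_fin mulr_ge0 ?sqr_ge0.
- exact: (measurable_int _ iMv).
Qed.

Lemma L2norm_le I u v (M : R) : 0 <= M -> L2fun I u -> L2fun I v ->
  (forall s, s \in I ->
    \sum_(i < n) u s 0 i ^+ 2 <= M ^+ 2 * \sum_(i < n) v s 0 i ^+ 2) ->
  L2norm I u <= M * L2norm I v.
Proof. by move=> M0 uI vI uv; apply: (L2norm_le_ae M0 uI vI); exact: aeW. Qed.

(** The parallelogram identity, whose other term is dropped. *)
Lemma L2norm_sqrD I u v : L2fun I u -> L2fun I v ->
  L2norm I (u + v) ^+ 2 <= 2 * L2norm I u ^+ 2 + 2 * L2norm I v ^+ 2.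
Proof.
move=> uI vI; have h1 := L2dot_quad 1 uI vI; have := L2dot_quad (-1) uI vI.
rewrite scale1r in h1; have := sqr_ge0 (L2norm I (-1 *: u + v)).
move: h1; lra.
Qed.

(** The factor 2 is harmless below, where only boundedness of operators matters. *)
Lemma L2norm_quasi_triangle I u v : L2fun I u -> L2fun I v ->
  L2norm I (u + v) <= 2 * (L2norm I u + L2norm I v).
Proof.
move=> uI vI; have := L2norm_sqrD uI vI.
have := L2norm_ge0 I u; have := L2norm_ge0 I v; have := L2norm_ge0 I (u + v).
move: (L2norm _ _) (L2norm _ _) (L2norm _ _) => x y z; nra.
Qed.

Lemma L2fun_translate I J h v : (forall s, s \in J -> h + s \in I) -> L2fun I v ->
  L2fun J (fun s => v (h + s)) /\ L2norm J (fun s => v (h + s)) <= L2norm I v.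
Proof.
move=> JI vI.
have mT f : measurable_fun (setT : set (measurableTypeR R)) f ->
  measurable_fun (setT : set (measurableTypeR R)) (fun s => f (h + s) : R).
  by move=> mf; apply: (measurableT_comp mf); exact: measurable_translation.
have mJ i : measurable_fun ([set` J] : set (measurableTypeR R)) (fun s => v (h + s) 0 i).
  have := mT _ (L2fun_measurable i vI) => /(measurable_funS measurableT (@subsetT _ [set` J])).
  apply: eq_measurable_fun => s /set_mem /= /JI sI.
  by rewrite patchE mem_set.
(* Used both for the square of a component and for the sum of these squares. *)
have key (F : 'rV[R]_n -> R) : F 0 = 0 -> (forall x, 0 <= F x) ->
    mu.-integrable [set` I] (EFin \o (F \o v)) ->
    measurable_fun ([set` J] : set (measurableTypeR R)) (fun s => F (v (h + s))) ->
    (\int[mu]_(s in [set` J]) (F (v (h + s)))%:E <= \int[mu]_(s in [set` I]) (F (v s))%:E)%E.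
  move=> F0 Fpos iF mF.
  rewrite [leRHS]integral_mkcond [leLHS]integral_mkcond.
  have mFI : measurable_fun (setT : set (measurableTypeR R))
     ((fun x : R => (F (v x))%:E) \_ [set` I]).
    by apply/(measurable_restrictT _ (mI I)); exact: (measurable_int _ iF).
  have FI0 s : (0 <= ((fun x : R => (F (v x))%:E) \_ [set` I]) s)%E.
    by rewrite patchE; case: ifP => // _; rewrite lee_fin.
  rewrite -(ge0_integral_translation h mFI)//.
  apply: ge0_le_integral => //.
  - by move=> s _; rewrite patchE; case: ifP => // _; rewrite lee_fin.
  - by apply/(measurable_restrictT _ (mI J)); exact/measurable_EFinP.
  - by apply: (measurableT_comp mFI); exact: measurable_translation.
  move=> s _; rewrite patchE; case: ifPn => [/set_mem /= /JI sI|_]; last exact: FI0.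
  by rewrite patchE mem_set.
have L2J : L2fun J (fun s => v (h + s)).
  apply/L2funP => i; split => //.
  have mv2 : measurable_fun ([set` J] : set (measurableTypeR R)) (fun s => v (h + s) 0 i ^+ 2).
    exact/measurable_funX.
  have /L2funP/(_ i)[_ iv2] := vI.
  apply/integrableP; split; first exact/measurable_EFinP.
  under eq_integral do rewrite /= ger0_norm ?sqr_ge0//.
  apply: (le_lt_trans (key (fun x => x 0 i ^+ 2) _ _ iv2 mv2)).
  - by rewrite mxE expr0n.
  - by move=> x; rewrite sqr_ge0.
  - case/integrableP : iv2 => _; apply: le_lt_trans.
    by rewrite le_eqVlt; apply/orP; left; apply/eqP/eq_integral => s _ /=; rewrite ger0_norm ?sqr_ge0.
split=> //; rewrite ler_wsqrtr//.
have iv := L2fun_sum_sqr vI; have iJ := L2fun_sum_sqr L2J.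
apply: fine_le.
- exact: (integrable_fin_num (mI J) iJ).
- exact: (integrable_fin_num (mI I) iv).
apply: (key (fun x => \sum_(i < n) x 0 i ^+ 2)) => //.
- by apply: big1 => i _; rewrite mxE expr0n.
- by move=> x; apply: sumr_ge0 => i _; rewrite sqr_ge0.
- by apply/measurable_EFinP; exact: (measurable_int _ iJ).
Qed.

End L2.

(** * Sobolev paths *)

Section sobolev_paths.
Context {R : realType} {n : nat}.
Implicit Types (I J : interval R) (u v w : R -> 'rV[R]_n).
Local Notation mu := (@lebesgue_measure R).

Lemma segment_subset I (s t : R) : s \in I -> t \in I -> `[s, t]%classic `<=` [set` I].
Proof. by move=> sI tI r /=; rewrite in_itv/=; exact: (@interval_is_interval _ I s t). Qed.

Lemma finite_itv (s t : R) : (mu `[s, t] < +oo)%E.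
Proof. by have := compact_finite_measure (@segment_compact _ s t). Qed.

Lemma L2fun_integrable_itv I v i (s t : R) : L2fun I v -> s \in I -> t \in I ->
  mu.-integrable `[s, t] (EFin \o (fun r => v r 0 i)).
Proof. by move=> vI sI tI; apply: L2fun_sub vI _ _; [exact: segment_subset|exact: finite_itv]. Qed.

(** Translation invariance of Lebesgue measure, applied to the weak derivative cut
    off outside of the interval of integration. *)
Lemma weak_derivative_translate I J h w v : (forall s, s \in J -> h + s \in I) ->
  weak_derivative I w v -> weak_derivative J (fun s => w (h + s)) (fun s => v (h + s)).
Proof.
move=> JI [vI hw]; split; first by have [] := L2fun_translate JI vI.
move=> i s t sJ tJ st; rewrite hw ?lerD2l//; try exact: JI.
have iv := L2fun_integrable_itv i vI (JI _ sJ) (JI _ tJ).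
congr fine; rewrite integral_mkcond [RHS]integral_mkcond.
have mg : measurable_fun [set: measurableTypeR R] ((fun r => (v r 0 i)%:E) \_ `[h + s, h + t]).
  by apply/(measurable_restrictT _ (measurable_itv _)); exact: (measurable_int _ iv).
rewrite -(integral_translation h mg); apply: eq_integral => r _.
have E : (h + r \in `[h + s, h + t]) = (r \in `[s, t]) by rewrite !in_itv/= !lerD2l.
rewrite !patchE; case: ifPn => [/set_mem /=|/negP hr].
  by rewrite E => rst; rewrite mem_set.
by case: ifPn => // /set_mem /=; rewrite -E => rst; case: hr; apply/mem_set.
Qed.

Lemma L2fun_mul_continuous (a b : R) (phi : R -> R) v : continuous phi ->
  L2fun `[a, b] v ->
  L2fun `[a, b] (fun s => phi s *: v s).
Proof.
move=> cphi vI; have [L L0 phiL] := continuous_bounded_itv a b cphi.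
apply: (L2fun_dominated (M := L) vI).
  move=> i; have := measurable_funM (@continuous_measurable_itv _ a b _ cphi) (L2fun_measurable_on i vI).
  by apply: eq_measurable_fun => s _; rewrite mxE.
move=> s i; rewrite in_itv/= => /andP[as_ sb].
by rewrite mxE normrM ler_wpM2r// phiL.
Qed.

Lemma L2norm_mul_bounded (a b : R) (phi : R -> R) v (L : R) : 0 <= L -> continuous phi ->
  (forall s, a <= s -> s <= b -> `|phi s| <= L) ->
  L2fun `[a, b] v ->
  L2norm `[a, b] (fun s => phi s *: v s) <= L * L2norm `[a, b] v.
Proof.
move=> L0 cphi phiL vI; apply: L2norm_le => //; first exact: L2fun_mul_continuous.
move=> s; rewrite in_itv/= => /andP[as_ sb]; rewrite mulr_sumr; apply: ler_sum => i _.
rewrite mxE exprMn ler_wpM2r ?sqr_ge0//.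
by rewrite -(real_normK (num_real (phi s))) lerXn2r ?nnegrE// phiL.
Qed.

Lemma weak_derivative_mul (a b : R) (phi psi : R -> R) w v :
  (forall x : R, is_derive x 1 phi (psi x)) -> continuous psi ->
  L2fun `[a, b] w -> weak_derivative `[a, b] w v ->
  weak_derivative `[a, b] (fun s => phi s *: w s)
    ((fun s => psi s *: w s) + (fun s => phi s *: v s)).
Proof.
move=> dphi cpsi wI [vI hw].
have cphi := is_derive_continuous dphi.
split.
  by rewrite -[X in X + _]scale1r; apply: L2fun_lin; exact: L2fun_mul_continuous.
move=> i s t sI tI st; rewrite !mxE.
rewrite (integral_product_rule (w := fun r => w r 0 i) (v := fun r => v r 0 i) st dphi cpsi).
- by apply: eq_Rintegral => r _; rewrite !fctE !mxE.
- exact: L2fun_integrable_itv vI sI tI.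
- exact: L2fun_integrable_itv wI sI tI.
move=> s' t' ss' st' tt'; apply: hw => //.
  by move: sI tI; rewrite !in_itv/= => /andP[? ?] /andP[? ?]; apply/andP; split; lra.
by move: sI tI; rewrite !in_itv/= => /andP[? ?] /andP[? ?]; apply/andP; split; lra.
Qed.

Lemma weak_derivative_ext I w w' v : (forall s, s \in I -> w s = w' s) ->
  weak_derivative I w v -> weak_derivative I w' v.
Proof. by move=> ww' [vI hw]; split => // i s t sI tI st; rewrite -(ww' s sI) -(ww' t tI); exact: hw. Qed.

Lemma L2fun_ext I v v' : (forall s, s \in I -> v s = v' s) -> L2fun I v -> L2fun I v'.
Proof.
move=> vv' vI i.
have <- : (fun s => v s 0 i) \_ [set` I] = (fun s => v' s 0 i) \_ [set` I].
  by apply/funext => s; rewrite !patchE; case: ifPn => // /set_mem/= sI; rewrite vv'.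
exact: vI.
Qed.

Lemma L2norm_ext I v v' : (forall s, s \in I -> v s = v' s) -> L2norm I v = L2norm I v'.
Proof.
by move=> vv'; congr Num.sqrt; apply: eq_Rintegral => s /set_mem sI; rewrite (vv' s sI).
Qed.

(** Extending by 0 changes neither the path nor its weak derivative on the
    interval, and elements of the path space are normalized that way. *)
Lemma sobolev12_intro I w v : mu [set` I] != 0%E -> L2fun I w -> weak_derivative I w v ->
  sobolev12 I (fun s => if s \in I then w s else 0).
Proof.
move=> I0 wI hw; have E s : s \in I -> w s = if s \in I then w s else 0 by move->.
split; first exact: L2fun_ext wI.
- by exists v; exact: weak_derivative_ext hw.
- by move=> s /negPf ->.
- by move=> I0'; rewrite I0' eqxx in I0.
Qed.

(** Any weak derivative can be used to estimate the norm, since all of them agree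
    almost everywhere with the one chosen in its definition. *)
Lemma W12_norm_le I (z : W12 n I) v : weak_derivative I z v ->
  `|z| <= L2norm I z + L2norm I v.
Proof.
move=> hv; rewrite W12_normE.
have -> : L2norm I (wderiv I z) = L2norm I v.
  have hz := W12_wderivP z.
  exact: L2norm_ae hz.1 hv.1 (weak_derivative_uniq hz hv).
have := L2norm_ge0 I z; have := L2norm_ge0 I v.
move: (L2norm _ _) (L2norm _ _) => x y x0 y0.
rewrite -(@ler_pXn2r _ 2) ?nnegrE ?sqrtr_ge0 ?addr_ge0// sqr_sqrtr; last by rewrite addr_ge0// sqr_ge0.
nra.
Qed.

Lemma L2norm_le_W12 I (z : W12 n I) : L2norm I z <= `|z|.
Proof.
rewrite W12_normE -{1}[L2norm I z]ger0_norm ?L2norm_ge0// -sqrtr_sqr ler_wsqrtr//.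
by rewrite lerDl sqr_ge0.
Qed.

Lemma L2norm_wderiv_le_W12 I (z : W12 n I) : L2norm I (wderiv I z) <= `|z|.
Proof.
rewrite W12_normE -{1}[L2norm I (wderiv I z)]ger0_norm ?L2norm_ge0// -sqrtr_sqr ler_wsqrtr//.
by rewrite lerDr sqr_ge0.
Qed.

(** Both summands of the pregluing map are of this form: translate, restrict to a
    compact interval, multiply by a cutoff function. The bounds come from those of
    the cutoff function and of its derivative on the compact interval. *)
Lemma cutoff_translate_bounded I (a b h : R) (phi psi : R -> R) :
  (forall s, s \in `[a, b] -> h + s \in I) ->
  (forall x : R, is_derive x 1 phi (psi x)) -> continuous psi ->
  exists2 K : R, 0 <= K & forall w : W12 n I, exists2 v,
   weak_derivative `[a, b] (fun s => phi s *: w (h + s)) v &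
   [/\ L2fun `[a, b] (fun s => phi s *: w (h + s)),
     L2norm `[a, b] (fun s => phi s *: w (h + s)) <= K * `|w| &
     L2norm `[a, b] v <= K * `|w|].
Proof.
move=> abI dphi cpsi.
have cphi := is_derive_continuous dphi.
have [L L0 phiL] := continuous_bounded_itv a b cphi.
have [L' L'0 psiL] := continuous_bounded_itv a b cpsi.
exists (L + 2 * (L + L')) => [|w]; first lra.
have [wI wle] := L2fun_translate abI (W12_L2 w).
have [vI vle] := L2fun_translate abI (W12_wderivP w).1.
have hw := weak_derivative_translate abI (W12_wderivP w).
have := weak_derivative_mul dphi cpsi wI hw.
set v := _ + _ => hv; exists v => //.
have w0 := le_trans wle (L2norm_le_W12 w).
have v0 := le_trans vle (L2norm_wderiv_le_W12 w).
have h1 := L2norm_mul_bounded L0 cphi phiL wI.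
have h2 := L2norm_mul_bounded L'0 cpsi psiL wI.
have h3 := L2norm_mul_bounded L0 cphi phiL vI.
have h4 := L2norm_quasi_triangle (L2fun_mul_continuous cpsi wI) (L2fun_mul_continuous cphi vI).
have b1 := ler_wpM2l L0 w0; have b2 := ler_wpM2l L'0 w0; have b3 := ler_wpM2l L0 v0.
have p1 := mulr_ge0 L0 (normr_ge0 w); have p2 := mulr_ge0 L'0 (normr_ge0 w).
rewrite !mulrDl mulrDr mulrDl -!mulrA.
split; [exact: L2fun_mul_continuous|by lra|].
by apply: (le_trans h4); lra.
Qed.

End sobolev_paths.

Section sup_bound.
Context {R : realType} {n : nat}.
Local Notation mu := (@lebesgue_measure R).

(** Not homogeneous, but it spares the Cauchy-Schwarz inequality: it is applied to
    paths of norm at most 1 only, and follows from |x| <= 1 + x ^ 2. *)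
Lemma L1norm_le_L2 (a b : R) (v : R -> 'rV[R]_n) i : a <= b -> L2fun `[a, b] v ->
  \int[mu]_(s in `[a, b]) `|v s 0 i| <= (b - a) + L2norm `[a, b] v ^+ 2.
Proof.
move=> ab vI; have mab : measurable (`[a, b]%classic : set (measurableTypeR R)) by [].
have iv : mu.-integrable `[a, b] (EFin \o (fun s => v s 0 i)).
  by apply: L2fun_integrable_itv vI _ _; rewrite in_itv/= lexx ab.
have iV : mu.-integrable `[a, b] (EFin \o (fun r => `|v r 0 i|)) by exact: integrable_norm.
have i1 : mu.-integrable `[a, b] (EFin \o (cst (1 : R) : R -> R)).
  by apply: integrable_continuous => ?; exact: cvg_cst.
have i2 := L2dot_integrable vI vI.
rewrite L2norm_sqr /L2dot -[b - a]mul1r -(Rintegral_cst_itv 1 ab) -(RintegralD mab i1 i2).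
apply: (le_Rintegral mab iV (integrableD mab i1 i2)) => s _ /=.
apply: (@le_trans _ _ (1 + v s 0 i * v s 0 i)).
  have [le1|/ltW ge1] := leP `|v s 0 i| 1.
    by rewrite (le_trans le1)// lerDl -expr2 sqr_ge0.
  rewrite -expr2 -(real_normK (num_real (v s 0 i))).
  by rewrite (le_trans (_ : _ <= `|v s 0 i| ^+ 2))// ?lerDr// ler_eXnr.
rewrite lerD2l (bigD1 i)//= lerDl; apply: sumr_ge0 => j _.
by rewrite -expr2 sqr_ge0.
Qed.

(** On a compact interval the W^{1,2} norm controls the sup norm: the value at s
    differs from every other value by at most the L^1 norm of the derivative, and
    averaging over the other values leaves the L^1 norm of the path. Paths of norm 1
    suffice by homogeneity. *)
Lemma W12_sup_bound (a b : R) : a < b -> exists2 K : R, 0 < K &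
  forall (z : W12 n `[a, b]) s i, s \in `[a, b] -> `|z s 0 i| <= K * `|z|.
Proof.
move=> ab; pose l := b - a; have l0 : 0 < l by rewrite subr_gt0.
have mab : measurable (`[a, b]%classic : set (measurableTypeR R)) by [].
(* l + 1 bounds the L^1 norms of a path of norm at most 1 and of its derivative. *)
pose K := (l + 1) / l + (l + 1).
have l1 : 0 < l + 1 by rewrite addr_gt0.
have K0 : 0 < K by rewrite addr_gt0 ?divr_gt0.
have unit (z : W12 n `[a, b]) s i : `|z| <= 1 -> s \in `[a, b] -> `|z s 0 i| <= K.
  move=> z1 sI; have [dI hd] := W12_wderivP z; have zI := W12_L2 z.
  set d := wderiv _ _ in dI hd.
  have sq v : 0 <= v -> v <= `|z| -> v ^+ 2 <= 1.
    by move=> v0 vz; rewrite expr_le1//; exact: le_trans z1.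
  have f1 : \int[mu]_(r in `[a, b]) `|z r 0 i| <= l + 1.
    apply: (le_trans (L1norm_le_L2 i (ltW ab) zI)).
    by rewrite lerD2l sq ?L2norm_ge0 ?L2norm_le_W12.
  have d1 : \int[mu]_(r in `[a, b]) `|d r 0 i| <= l + 1.
    apply: (le_trans (L1norm_le_L2 i (ltW ab) dI)).
    by rewrite lerD2l sq ?L2norm_ge0 ?L2norm_wderiv_le_W12.
  have aI : a \in `[a, b] by rewrite in_itv/= lexx ltW.
  have bI : b \in `[a, b] by rewrite in_itv/= lexx ltW.
  have id := L2fun_integrable_itv i dI aI bI.
  have iD : mu.-integrable `[a, b] (EFin \o (fun r => `|d r 0 i|)) by exact: integrable_norm.
  have iz := L2fun_integrable_itv i zI aI bI.
  have iZ : mu.-integrable `[a, b] (EFin \o (fun r => `|z r 0 i|)) by exact: integrable_norm.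
  have osc r t : a <= r -> r <= t -> t <= b -> `|z t 0 i - z r 0 i| <= l + 1.
    move=> ar rt tb; rewrite hd//; try by rewrite in_itv/=; apply/andP; split; lra.
    apply: (le_trans (le_normr_Rintegral _ _)) => //; first exact: integrable_sub id.
    apply: le_trans d1; rewrite (@Rintegral_chasles _ a r b)//; last lra.
    rewrite (@Rintegral_chasles _ r t b)//; last exact: integrable_sub iD.
    by rewrite addrA -[leLHS]add0r -[leLHS]addr0 !lerD// Rintegral_ge0.
  have low r : r \in `[a, b] -> `|z s 0 i| - (l + 1) <= `|z r 0 i|.
    move: sI; rewrite !in_itv/= => /andP[as_ sb] /andP[ar rb].
    rewrite lerBlDr -lerBlDl; apply: (le_trans (lerB_dist _ _)).
    have [rs|/ltW sr] := leP r s; first exact: osc.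
    by rewrite distrC; exact: osc.
  have : (`|z s 0 i| - (l + 1)) * l <= l + 1.
    apply: le_trans f1; rewrite -(Rintegral_cst_itv _ (ltW ab)).
    apply: le_Rintegral => //.
    by apply: integrable_continuous => ?; exact: cvg_cst.
  by rewrite -ler_pdivlMr// lerBlDr.
exists K => // z s i sI; have [->|z0] := eqVneq z 0.
  by rewrite normr0 mulr0 /= mxE normr0.
have zp : 0 < `|z| by rewrite normr_gt0.
have h := unit (`|z|^-1 *: z) s i; rewrite -ler_pdivrMr//.
have E : W12_fun (`|z|^-1 *: z) s 0 i = `|z|^-1 * z s 0 i.
  have -> : W12_fun (`|z|^-1 *: z) = `|z|^-1 *: W12_fun z by [].
  by rewrite fctE mxE.
move: h; rewrite E normrM normfV normr_id mulrC; apply => //.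
by rewrite normrZ normfV normr_id mulVf// gt_eqF.
Qed.

End sup_bound.

(** * The pregluing map *)

Lemma norm_fst_le (R : realType) (V W : normedModType R) (w : V * W) : `|w.1| <= `|w|.
Proof. by rewrite prod_normE le_max lexx. Qed.

Lemma norm_snd_le (R : realType) (V W : normedModType R) (w : V * W) : `|w.2| <= `|w|.
Proof. by rewrite prod_normE le_max lexx orbT. Qed.

Section pregluing.
Context {R : realType} {n : nat}.
Local Notation mu := (@lebesgue_measure R).
Variables (T : R) (beta : R -> R).
Hypotheses (T0 : 0 < T) (sbeta : smooth beta).

Lemma smooth_is_derive (x : R) : is_derive x 1 beta ('D_1 beta x).
Proof. by apply: DeriveDef => //; apply: diff_derivable; exact: (sbeta [::]). Qed.

Lemma smooth_derive_continuous : continuous ('D_1 beta : R -> R).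
Proof. by move=> x; apply: differentiable_continuous; exact: (sbeta [:: 1]). Qed.

Lemma is_derive_translate (c x : R) :
  is_derive x 1 (fun s => beta (s + c)) ('D_1 beta (x + c)).
Proof.
have h : is_derive (x + c) 1 beta ('D_1 beta (x + c)) := smooth_is_derive (x + c).
have := @is_derive1_comp _ beta (shift c) x _ _ h (is_derive_shift x 1 c).
by rewrite mulr1.
Qed.

Lemma continuous_derive_translate (c : R) : continuous (fun s => 'D_1 beta (s + c)).
Proof.
move=> x; apply: (@continuous_comp _ _ _ (fun s => s + c) ('D_1 beta)).
  by apply: continuousD; [exact: cvg_id|exact: cvg_cst].
exact: smooth_derive_continuous.
Qed.

Let phi1 s := 1 - beta (s + 2).
Let psi1 s := - 'D_1 beta (s + 2).
Let phi2 s := beta (s - 2).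
Let psi2 s := 'D_1 beta (s - 2).

Let dphi1 (x : R) : is_derive x 1 phi1 (psi1 x).
Proof.
have h := is_derive_translate 2 x.
have := is_deriveB (is_derive_cst (1 : R) x (1:R)) h.
by rewrite sub0r.
Qed.

Let cpsi1 : continuous psi1.
Proof. by move=> x; apply: cvgN; exact: continuous_derive_translate. Qed.

(** The path to which the pregluing map applies its extension by 0. *)
Definition preglue_fun (w : Wplus R n * Wminus R n) (s : R) : 'rV[R]_n :=
  phi1 s *: w.1 (T + s) + phi2 s *: w.2 (- T + s).

Lemma preglue_weak_derivative : exists2 K : R, 0 <= K & forall w,
  exists2 v, weak_derivative `[- T, T] (preglue_fun w) v &
    [/\ L2fun `[- T, T] (preglue_fun w),
     L2norm `[- T, T] (preglue_fun w) <= K * `|w| & L2norm `[- T, T] v <= K * `|w|].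
Proof.
have [|K1 K10 h1] := @cutoff_translate_bounded R n `[0, +oo[ (- T) T T phi1 psi1 _ dphi1 cpsi1.
  by move=> s; rewrite !in_itv/= andbT => /andP[]; lra.
have [|K2 K20 h2] := @cutoff_translate_bounded R n `]-oo, 0] (- T) T (- T) phi2 psi2 _
  (is_derive_translate (- 2)) (@continuous_derive_translate (-2)).
  by move=> s; rewrite !in_itv/= => /andP[]; lra.
exists (2 * (K1 + K2)) => [|w]; first lra.
have [v1 d1 [l1 b1 c1]] := h1 w.1; have [v2 d2 [l2 b2 c2]] := h2 w.2.
have w1 := norm_fst_le w; have w2 := norm_snd_le w.
have e1 := ler_wpM2l K10 w1; have e2 := ler_wpM2l K20 w2.
exists (v1 + v2).
  by have := weak_derivative_lin 1 d1 d2; rewrite !scale1r.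
split.
- by have := L2fun_lin 1 l1 l2; rewrite scale1r.
- by apply: (le_trans (L2norm_quasi_triangle l1 l2)); rewrite -mulrA ler_pM2l// mulrDl lerD ?(le_trans b1)// (le_trans b2).
- by apply: (le_trans (L2norm_quasi_triangle d1.1 d2.1)); rewrite -mulrA ler_pM2l// mulrDl lerD ?(le_trans c1)// (le_trans c2).
Qed.

Lemma mu_symmetric_itv_neq0 : mu [set` `[- T, T]] != 0%E.
Proof.
have lt : - T < T by rewrite (lt_trans _ T0)// oppr_lt0.
by rewrite lebesgue_measure_itv/= lte_fin lt -EFinB eqe subr_eq0 gt_eqF.
Qed.

(** The formula of the pregluing map is a Sobolev path, so that the default value
    in its definition is never taken. *)
Lemma preglueE w : W12_fun (preglue T beta w) =
  fun s => if s \in `[- T, T] then preglue_fun w s else 0.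
Proof.
rewrite /preglue (insubdK (T := _)) //; apply/asboolP.
have [K _ /(_ w)[v dv [lv _ _]]] := preglue_weak_derivative.
exact: sobolev12_intro mu_symmetric_itv_neq0 lv dv.
Qed.

Lemma preglue_linear : linear (preglue T beta : Wplus R n * Wminus R n -> WT n T).
Proof.
move=> a u v; apply/val_inj/funext => s.
change (W12_fun (preglue T beta (a *: u + v)) s =
  a *: W12_fun (preglue T beta u) s + W12_fun (preglue T beta v) s).
rewrite !preglueE; case: ifP => _; last by rewrite scaler0 addr0.
have E1 : W12_fun (a *: u + v).1 = a *: W12_fun u.1 + W12_fun v.1 by [].
have E2 : W12_fun (a *: u + v).2 = a *: W12_fun u.2 + W12_fun v.2 by [].
rewrite /preglue_fun E1 E2 !fctE !scalerDr !scalerA ![phi1 s * a]mulrC ![phi2 s * a]mulrC.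
by rewrite addrACA.
Qed.

Lemma preglue_bounded : exists2 K : R, 0 <= K &
  forall w : Wplus R n * Wminus R n, `|preglue T beta w| <= K * `|w|.
Proof.
have [K K0 h] := preglue_weak_derivative.
exists (2 * K) => [|w]; first lra.
have [v dv [lv b1 b2]] := h w.
have E s : s \in `[- T, T] -> preglue_fun w s = preglue T beta w s.
  by move=> sT; rewrite preglueE sT.
apply: (le_trans (W12_norm_le (weak_derivative_ext E dv))).
by rewrite -(L2norm_ext E); lra.
Qed.

End pregluing.

(** * The linearized flow and its projection *)

Section euclidean_norm.
Context {R : realType} {n : nat}.

Lemma enorm_ge0 (x : 'rV[R]_n) : 0 <= enorm x. Proof. exact: sqrtr_ge0. Qed.

Lemma enorm_sqr (x : 'rV[R]_n) : enorm x ^+ 2 = \sum_i x 0 i ^+ 2.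
Proof. by rewrite sqr_sqrtr// sumr_ge0// => i _; rewrite sqr_ge0. Qed.

End euclidean_norm.

Lemma subrBB (V : zmodType) (u p e : V) : p - e = (u - e) - (u - p).
Proof. by rewrite opprB [RHS]addrC addrA subrK. Qed.

Lemma scalerB_add (R : pzRingType) (V : lmodType R) (b : R) (u v p q : V) :
  b *: u + v - (b *: p + q) = b *: (u - p) + (v - q).
Proof. by rewrite scalerBr opprD addrACA. Qed.

Section linear_flow.
Context {R : realType} {n : nat}.
Local Notation mu := (@lebesgue_measure R).
Variable a : 'rV[R]_n.

Lemma ae_and (P Q S : R -> Prop) : (forall x, P x -> Q x -> S x) ->
  {ae mu, forall x, P x} -> {ae mu, forall x, Q x} -> {ae mu, forall x, S x}.
Proof. by move=> PQS; apply: filterS2; first exact: (ae_filter_ringOfSetsType mu). Qed.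

Lemma linfieldE (x : 'rV[R]_n) i : linfield a x 0 i = x 0 i * a 0 i.
Proof. by rewrite /linfield mul_mx_diag mxE. Qed.

Lemma neg_linfieldE (z : R -> 'rV[R]_n) s i :
  (-1 *: (fun s => linfield a (z s)) + cst 0) s 0 i = - (z s 0 i * a 0 i).
Proof.
have -> : (-1 *: (fun s => linfield a (z s)) + cst 0) s 0 i = -1 * linfield a (z s) 0 i + 0.
  by rewrite !fctE [LHS]mxE; congr (_ + _); rewrite mxE.
by rewrite linfieldE; ring.
Qed.

Lemma linfield_lin (b : R) (x y : 'rV[R]_n) :
  linfield a (b *: x + y) = b *: linfield a x + linfield a y.
Proof. by rewrite /linfield mulmxDl scalemxAl. Qed.

Lemma linfield_bound : exists2 M : R, 0 <= M & forall x i, `|linfield a x 0 i| <= M * `|x 0 i|.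
Proof.
exists (\sum_i `|a 0 i|) => [|x i]; first exact: sumr_ge0.
rewrite linfieldE normrM mulrC ler_wpM2r// (bigD1 i)//= lerDl.
exact: sumr_ge0.
Qed.

Lemma L2fun_linfield (I : interval R) (w : R -> 'rV[R]_n) : L2fun I w ->
  L2fun I (fun s => linfield a (w s)).
Proof.
have [M M0 hM] := linfield_bound; move=> wI; apply: (L2fun_dominated (M := M) wI).
  move=> i; have := measurable_funM (L2fun_measurable_on i wI) (measurable_cst (a 0 i)).
  by apply: eq_measurable_fun => s _; rewrite linfieldE.
by move=> s i _; exact: hM.
Qed.

Lemma L2norm_linfield : exists2 M : R, 0 <= M &
  forall (I : interval R) (w : R -> 'rV[R]_n), L2fun I w ->
  L2norm I (fun s => linfield a (w s)) <= M * L2norm I w.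
Proof.
have [M M0 hM] := linfield_bound; exists M => // I w wI.
apply: L2norm_le => //; first exact: L2fun_linfield.
move=> s _; rewrite mulr_sumr; apply: ler_sum => i _.
rewrite -exprMn -(real_normK (num_real (linfield _ _ _ _))).
rewrite -(real_normK (num_real (M * _))) lerXn2r ?nnegrE//.
by rewrite normrM (ger0_norm M0).
Qed.

Lemma weak_derivative_ae (I : interval R) (w v v' : R -> 'rV[R]_n) :
  weak_derivative I w v -> L2fun I v' -> v = v' %[ae mu in [set` I]] ->
  weak_derivative I w v'.
Proof.
move=> [vI hw] vI' vv'; split => // i s t sI tI st; rewrite hw//.
congr fine; apply: ae_eq_integral => //.
- exact: (measurable_int _ (L2fun_integrable_itv i vI sI tI)).
- exact: (measurable_int _ (L2fun_integrable_itv i vI' sI tI)).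
- by apply: ae_sub vv' => r h rst; have -> : v r = v' r by apply: h; apply: (segment_subset sI tI).
Qed.

(** The equation z' + A z = v, which holds almost everywhere for the chosen weak
    derivative, says that v - A z is a weak derivative; this form is convenient as
    v - A z is an explicit function. *)
Lemma linear_flowP (I : interval R) (z : W12 n I) (v : R -> 'rV[R]_n) : L2fun I v ->
  (flowop (linfield a) z = v %[ae mu in [set` I]] <->
   weak_derivative I z (-1 *: (fun s => linfield a (z s)) + v)).
Proof.
move=> vI; have zd := W12_wderivP z; have zA := L2fun_linfield (W12_L2 z).
have L := L2fun_lin (-1) zA vI.
split=> [h|h].
  apply: weak_derivative_ae zd L _.
  by apply: ae_sub h => s h /h; rewrite !fctE /flowop => <-; rewrite scaleN1r addrC addrK.
apply: ae_sub (weak_derivative_uniq zd h) => s {}h /h.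
by rewrite !fctE /flowop => ->; rewrite scaleN1r addrAC addNr add0r.
Qed.

Lemma solutions_linP (I : interval R) (z : W12 n I) :
  solutions (linfield a) I z <->
  weak_derivative I z (-1 *: (fun s => linfield a (z s)) + cst 0).
Proof. exact: linear_flowP (L2fun0 _). Qed.

Lemma L2fun_flowop (I : interval R) (z : W12 n I) : L2fun I (flowop (linfield a) z).
Proof.
have := L2fun_lin 1 (W12_wderivP z).1 (L2fun_linfield (W12_L2 z)).
by rewrite scale1r.
Qed.

Lemma L2norm_flowop : exists2 M : R, 0 <= M & forall (I : interval R) (z : W12 n I),
  L2norm I (flowop (linfield a) z) <= M * `|z|.
Proof.
have [M M0 hM] := L2norm_linfield; exists (2 * (1 + M)) => [|I z]; first lra.
have zI := W12_L2 z.
apply: (le_trans (L2norm_quasi_triangle (W12_wderivP z).1 (L2fun_linfield zI))).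
have h1 := L2norm_wderiv_le_W12 z; have h2 := hM I z zI.
have h3 := ler_wpM2l M0 (L2norm_le_W12 z).
by move: h1 h2 h3; lra.
Qed.

(** Linearity holds almost everywhere only, since weak derivatives are chosen
    independently for each path. *)
Lemma flowop_lin (I : interval R) (z e : W12 n I) (b : R) :
  flowop (linfield a) (b *: z + e) =
   b *: flowop (linfield a) z + flowop (linfield a) e %[ae mu in [set` I]].
Proof.
have hd := weak_derivative_lin b (W12_wderivP z) (W12_wderivP e).
have := weak_derivative_uniq (W12_wderivP (b *: z + e)) hd.
apply: ae_sub => s h /h; rewrite /flowop !fctE => ->.
have -> : W12_fun (b *: z + e) s = b *: z s + e s by [].
by rewrite linfield_lin scalerDr addrACA.
Qed.

Lemma solutions_lin (I : interval R) (z e : W12 n I) (b : R) :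
  solutions (linfield a) I z -> solutions (linfield a) I e ->
  solutions (linfield a) I (b *: z + e).
Proof.
rewrite /solutions /= => hz he; have := flowop_lin z e b.
apply: ae_and (ae_and (fun _ p q => conj p q) hz he) => s [h1 h2] h3 sI.
by rewrite (h3 sI) !fctE h1// h2// scaler0 addr0.
Qed.

Variables (k : nat) (T : R).
Hypothesis T0 : 0 < T.
Local Notation J := (`[- T, T] : interval R).

Let lJ : - T \in J. Proof. by rewrite in_itv/= lexx -subr_ge0 opprK addr_ge0// ltW. Qed.
Let rJ : T \in J. Proof. by rewrite in_itv/= lexx -subr_ge0 opprK addr_ge0// ltW. Qed.

Lemma KT_lin (z e : WT n T) (b : R) : KT k T z -> KT k T e -> KT k T (b *: z + e).
Proof.
move=> hz he i; have := hz i; have := he i.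
have E s : W12_fun (b *: z + e) s 0 i = b * z s 0 i + e s 0 i.
  by have -> : W12_fun (b *: z + e) s = b *: z s + e s by []; rewrite !mxE.
by case: ifP => _ e0 z0; rewrite E e0 z0 mulr0 addr0.
Qed.

Lemma KT_sub (z e : WT n T) : KT k T z -> KT k T e -> KT k T (z - e).
Proof.
move=> hz he; have -> : z - e = -1 *: e + z by rewrite scaleN1r addrC.
exact: KT_lin.
Qed.

Lemma expR_is_derive (b t x : R) :
  is_derive x 1 (fun s => expR (b * (s - t))) (b * expR (b * (x - t))).
Proof.
have h1 : is_derive x 1 (fun s : R => b * (s - t)) b.
  have := is_deriveZ b (is_derive_shift x 1 (- t)).
  by rewrite /GRing.scale/= mulr1.
have := @is_derive1_comp _ expR (fun s : R => b * (s - t)) x _ _ (is_derive_expR _) h1.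
by rewrite mulrC.
Qed.

Lemma continuous_expR_affine (b t : R) : continuous (fun s => expR (b * (s - t))).
Proof. exact: is_derive_continuous (expR_is_derive b t). Qed.

Lemma continuous_d_expR_affine (b t : R) : continuous (fun s => b * expR (b * (s - t))).
Proof. by move=> x; apply: cvgMr; exact: continuous_expR_affine. Qed.

(** For a solution of the linearized equation exp(a_i s) z_i(s) is constant by the
    product rule. In K_T every component vanishes at one of the two ends. *)
Lemma linear_flow_eq0 (e : WT n T) : solutions (linfield a) J e -> KT k T e -> e = 0.
Proof.
move=> /solutions_linP; set v := _ + _ => -[vI hv] eK.
have key i s t : s \in J -> t \in J -> s <= t ->
    expR (a 0 i * (t - 0)) * e t 0 i = expR (a 0 i * (s - 0)) * e s 0 i.
  move=> sJ tJ st; apply/eqP; rewrite -subr_eq0; apply/eqP.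
  rewrite (integral_product_rule (w := fun r => e r 0 i) (v := fun r => v r 0 i) st
     (expR_is_derive (a 0 i) 0) (@continuous_d_expR_affine _ _)).
  - rewrite (@eq_Rintegral _ _ _ _ _ (cst 0)) ?Rintegral_cst_itv ?mul0r//.
    by move=> r _; rewrite /v neg_linfieldE /=; ring.
  - exact: L2fun_integrable_itv vI sJ tJ.
  - exact: L2fun_integrable_itv (W12_L2 e) sJ tJ.
  by move=> s' t' ss' st' tt'; apply: hv => //;
    move: sJ tJ; rewrite !in_itv/= => /andP[? ?] /andP[? ?]; apply/andP; split; lra.
have z0 i s : s \in J -> e s 0 i = 0.
  move=> sJ; have /andP[Ts sT] : - T <= s <= T by move: sJ; rewrite in_itv.
  have := eK i; case: ifP => _ e0.
    have := key i _ _ lJ sJ Ts; rewrite e0 mulr0 => /eqP.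
    by rewrite mulf_eq0 gt_eqF ?expR_gt0//= => /eqP.
  have := key i _ _ sJ rJ sT; rewrite e0 mulr0 => /esym/eqP.
  by rewrite mulf_eq0 gt_eqF ?expR_gt0//= => /eqP.
apply/val_inj/funext => s /=; have [sJ|sJ] := boolP (s \in J).
  by apply/rowP => i; rewrite z0// mxE.
by have [_ _ /(_ s sJ) -> _] := W12P e.
Qed.

Lemma L2fun_continuous (b c : R) (v : R -> 'rV[R]_n) :
  (forall i, continuous (fun s => v s 0 i)) -> L2fun `[b, c] v.
Proof.
move=> cv; apply/L2funP => i; split; first exact: continuous_measurable_itv.
by apply: integrable_continuous => x; exact: (cvgM (cv i x) (cv i x)).
Qed.

(** The i-th component of the projection is the multiple of exp(- a_i s) that
    agrees with u at the end where the i-th component of elements of K_T vanishes,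
    which is - T for i < n - k and T for the other i. *)
Lemma linear_flow_exists (u : WT n T) : exists e : WT n T,
  solutions (linfield a) J e /\ KT k T (u - e).
Proof.
pose tau (i : 'I_n) : R := if (i < n - k)%N then - T else T.
pose E s : 'rV[R]_n := \row_i (expR (- a 0 i * (s - tau i)) * u (tau i) 0 i).
pose D s : 'rV[R]_n := \row_i ((- a 0 i * expR (- a 0 i * (s - tau i))) * u (tau i) 0 i).
have EI : L2fun J E.
  apply: L2fun_continuous => i; under eq_fun do rewrite mxE.
  by move=> x; apply: cvgMl; exact: continuous_expR_affine.
have DI : L2fun J D.
  apply: L2fun_continuous => i; under eq_fun do rewrite mxE.
  by move=> x; apply: cvgMl; exact: continuous_d_expR_affine.
have ED : weak_derivative J E D.
  split=> // i s t sJ tJ st; rewrite !mxE -mulrBl.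
  under eq_Rintegral do rewrite mxE.
  rewrite RintegralZr//; last first.
    by apply: integrable_continuous; exact: continuous_d_expR_affine.
  by rewrite (Rintegral_derivative st (expR_is_derive _ _) (@continuous_d_expR_affine _ _)).
have J0 : mu [set` J] != 0%E.
  have lt : - T < T by rewrite (lt_trans _ T0)// oppr_lt0.
  by rewrite lebesgue_measure_itv/= lte_fin lt -EFinB eqe subr_eq0 gt_eqF.
have /asboolP eP := sobolev12_intro J0 EI ED.
pose e : WT n T := MkW12 eP; exists e.
have eE s : s \in J -> E s = e s by move=> /= ->.
split.
  apply/solutions_linP; have dE := weak_derivative_ext eE ED.
  apply: (weak_derivative_ae dE).
    exact: L2fun_lin (L2fun_linfield (W12_L2 e)) (L2fun0 _).
  apply: aeW => s sJ; apply/rowP => i.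
  by rewrite neg_linfieldE -eE// !mxE; ring.
move=> i; have EE s : s \in J -> W12_fun (u - e) s 0 i = u s 0 i - E s 0 i.
  by move=> sJ; rewrite eE//; have -> : W12_fun (u - e) s = u s - e s by []; rewrite !mxE.
have eT : E (tau i) 0 i = u (tau i) 0 i by rewrite mxE subrr mulr0 expR0 mul1r.
by move: eT; rewrite {1 2}/tau; case: ifP => _ eT; rewrite EE// eT subrr.
Qed.

Lemma PiTP (u : WT n T) :
  solutions (linfield a) J (PiT k T a u) /\ KT k T (u - PiT k T a u).
Proof. exact: (xgetPex 0 (linear_flow_exists u)). Qed.

Lemma PiT_unique (u e : WT n T) : solutions (linfield a) J e -> KT k T (u - e) ->
  PiT k T a u = e.
Proof.
have [s1 k1] := PiTP u; move=> s2 k2; apply/eqP; rewrite -subr_eq0; apply/eqP.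
apply: linear_flow_eq0.
  have -> : PiT k T a u - e = -1 *: e + PiT k T a u by rewrite scaleN1r addrC.
  exact: solutions_lin.
by rewrite (subrBB u); exact: KT_sub.
Qed.

Lemma PiT_linear : linear (PiT k T a : WT n T -> WT n T).
Proof.
move=> b u v; have [s1 k1] := PiTP u; have [s2 k2] := PiTP v.
apply: PiT_unique; first exact: solutions_lin.
have -> : b *: u + v - (b *: PiT k T a u + PiT k T a v) =
    b *: (u - PiT k T a u) + (v - PiT k T a v) := scalerB_add b u v _ _.
exact: (KT_lin b k1 k2).
Qed.

(** By uniqueness of solutions in K_T, every element of K_T is the value of Q_T at
    its image under the linearized operator. *)
Lemma QT_unique (z : WT n T) (v : R -> 'rV[R]_n) : KT k T z ->
  flowop (linfield a) z = v %[ae mu in [set` J]] -> QT k T a v = z.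
Proof.
move=> zK zv.
have [yK yv] : [set z : WT n T | KT k T z /\
    flowop (linfield a) z = v %[ae mu in [set` J]]] (QT k T a v).
  by apply: (xgetPex 0); exists z.
apply/eqP; rewrite -subr_eq0; apply/eqP; apply: linear_flow_eq0; last exact: KT_sub.
have := flowop_lin z (QT k T a v) (-1); rewrite scaleN1r addrC.
apply: ae_and (ae_and (fun _ p q => conj p q) zv yv) => s [h1 h2] h3 sI.
by rewrite (h3 sI) !fctE h1// h2// scaleN1r addNr.
Qed.

Variable c : R.
Hypothesis c0 : 0 < c.
Hypothesis hQ : forall v : R -> 'rV[R]_n, L2fun J v -> `|QT k T a v| <= c * L2norm J v.

(** The bound on Q_T, read on its image. *)
Lemma KT_norm_le (z : WT n T) : KT k T z ->
  `|z| <= c * L2norm J (flowop (linfield a) z).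
Proof.
move=> zK; rewrite -{1}(@QT_unique z (flowop (linfield a) z))//.
  by apply: hQ; exact: L2fun_flowop.
exact: aeW.
Qed.

(** The complementary projection u - Pi_T u is Q_T (D_T u), so that its bound is
    that of Q_T times that of D_T. *)
Lemma PiT_bounded : exists2 K : R, 0 <= K & forall u : WT n T, `|PiT k T a u| <= K * `|u|.
Proof.
have [M M0 hM] := L2norm_flowop; exists (1 + c * M) => [|u].
  by rewrite addr_ge0// mulr_ge0// ltW.
have [sP kP] := PiTP u; rewrite -[PiT k T a u](subKr u).
apply: (le_trans (ler_normB _ _)); rewrite mulrDl mul1r lerD2l.
apply: (le_trans (KT_norm_le kP)); rewrite -mulrA ler_pM2l//.
apply: le_trans (hM _ u); rewrite le_eqVlt; apply/orP; left; apply/eqP.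
apply: L2norm_ae; [exact: L2fun_flowop..|].
have := flowop_lin (PiT k T a u) u (-1); rewrite scaleN1r addrC.
by apply: ae_and sP => s h1 h2 sI; rewrite h2// !fctE h1// scaler0 add0r.
Qed.

(** The difference of z and Pi_T u lies in K_T and is mapped to A z - X(z) by the
    linearized operator, so the bound on Q_T controls it by the nonlinear part of X
    along z. *)
Lemma newton_picard_close (X : 'rV[R]_n -> 'rV[R]_n) (u z : WT n T) (M : R) : 0 <= M ->
  solutions X J z -> KT k T (z - u) ->
  (forall s, s \in J -> enorm (X (z s) - linfield a (z s)) <= M * enorm (z s)) ->
  `|z - PiT k T a u| <= c * M * `|z|.
Proof.
move=> M0 zX zK zM; have [sP kP] := PiTP u.
have kK : KT k T (z - PiT k T a u).
  have -> : z - PiT k T a u = 1 *: (z - u) + (u - PiT k T a u).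
    by rewrite scale1r addrA subrK.
  exact: (KT_lin 1 zK kP).
apply: (le_trans (KT_norm_le kK)); rewrite -mulrA ler_pM2l//.
apply: (@le_trans _ _ (M * L2norm J z)); last by rewrite ler_wpM2l// L2norm_le_W12.
apply: L2norm_le_ae => //; [exact: L2fun_flowop|exact: W12_L2|].
have := flowop_lin (PiT k T a u) z (-1); rewrite scaleN1r addrC.
apply: ae_and (ae_and (fun _ p q => conj p q) zX sP) => s [h1 h2] h3 sI.
have h : flowop (linfield a) (z - PiT k T a u) s = - (X (z s) - linfield a (z s)).
  rewrite h3// !fctE h2// scaler0 add0r opprB.
  by have /eqP := h1 sI; rewrite /flowop addr_eq0 => /eqP ->; rewrite addrC.
rewrite h -!enorm_sqr -exprMn lerXn2r ?nnegrE ?sqrtr_ge0 ?mulr_ge0 ?sqrtr_ge0//.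
apply: le_trans (zM s sI); rewrite /enorm le_eqVlt; apply/orP; left; apply/eqP.
by congr Num.sqrt; apply: eq_bigr => i _; rewrite mxE sqrrN.
Qed.

End linear_flow.

(** * The gradient vector field near its zero *)

Section differentiability.
Context {R : realType} {V : normedModType R}.

Lemma differentiable_bigsum (I : Type) (r : seq I) (P : pred I) (F : I -> V -> R) (x : V) :
  (forall i, differentiable (F i) x) ->
  differentiable (fun y => \sum_(i <- r | P i) F i y) x.
Proof.
move=> dF; elim: r => [|i r IH].
  by under eq_fun do rewrite big_nil; exact: differentiable_cst.
under eq_fun do rewrite big_cons; case: (P i) => //.
exact: differentiableD.
Qed.

Lemma differentiable_bigprod (I : Type) (r : seq I) (P : pred I) (F : I -> V -> R) (x : V) :
  (forall i, differentiable (F i) x) ->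
  differentiable (fun y => \prod_(i <- r | P i) F i y) x.
Proof.
move=> dF; elim: r => [|i r IH].
  by under eq_fun do rewrite big_nil; exact: differentiable_cst.
under eq_fun do rewrite big_cons; case: (P i) => //.
exact: differentiableM.
Qed.

Lemma differentiable_row n (F : V -> 'rV[R]_n) (x : V) :
  (forall j, differentiable (fun y => F y 0 j) x) -> differentiable F x.
Proof.
move=> dF; have -> : F = \sum_(j < n) (fun y => F y 0 j *: delta_mx 0 j).
  by apply/funext => y; rewrite fct_sumE {1}[F y]row_sum_delta.
by apply: differentiable_sum => j; exact: differentiableZl.
Qed.

Lemma differentiable_det n (A : V -> 'M[R]_n) (x : V) :
  (forall i j, differentiable (fun y => A y i j) x) ->
  differentiable (fun y => \det (A y)) x.
Proof.
move=> dA; rewrite /determinant; apply: differentiable_bigsum => s.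
apply: differentiableM; first exact: differentiable_cst.
by apply: differentiable_bigprod.
Qed.

Lemma differentiable_cofactor n (A : V -> 'M[R]_n) i j (x : V) :
  (forall i j, differentiable (fun y => A y i j) x) ->
  differentiable (fun y => cofactor (A y) i j) x.
Proof.
move=> dA; under eq_fun do rewrite expand_cofactor.
apply: differentiable_bigsum => s.
apply: differentiableM; first exact: differentiable_cst.
by apply: differentiable_bigprod.
Qed.

(** Cramer's rule: the entries of the inverse are polynomials in the entries of
    the matrix divided by the determinant. *)
Lemma differentiable_invmx n (A : V -> 'M[R]_n) i j (x : V) :
  (forall i j, differentiable (fun y => A y i j) x) -> (forall y, A y \in unitmx) ->
  differentiable (fun y => invmx (A y) i j) x.
Proof.
move=> dA uA.
have -> : (fun y => invmx (A y) i j) = (fun y => (\det (A y))^-1 * cofactor (A y) j i).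
  by apply/funext => y; rewrite /invmx uA !mxE.
apply: differentiableM; last exact: differentiable_cofactor.
apply: differentiableV; first exact: differentiable_det.
by have := uA x; rewrite unitmxE unitfE.
Qed.

End differentiability.

Section gradient.
Context {R : realType} {n : nat}.
Variables (f : 'rV[R]_n -> R) (g : 'rV[R]_n -> 'M[R]_n) (a : 'rV[R]_n).
Hypotheses (hf : smooth f) (hg : riemannian_metric g).

Lemma metric_unit x : g x \in unitmx.
Proof.
have [_ _ pos] := hg; rewrite unitmxE unitfE; apply/negP => /det0P[v v0 vg].
by have := pos x v v0; rewrite vg mul0mx mxE ltxx.
Qed.

Lemma metric_coord_differentiable x i j : differentiable (fun y => g y i j) x.
Proof.
have [sg _ _] := hg.
have := @differentiable_comp _ _ _ _ g (fun N : 'M[R]_n => N i j : R) x (sg [::] x).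
by apply; exact: differentiable_coord.
Qed.

Let p i := 'D_(delta_mx 0 i : 'rV[R]_n) f.
Let h i j x := invmx (g x) i j.

Let dp i x : differentiable (p i) x. Proof. exact: (hf [:: delta_mx 0 i]). Qed.
Let dh i j x : differentiable (h i j) x.
Proof. by apply: differentiable_invmx => *; [exact: metric_coord_differentiable|exact: metric_unit]. Qed.

Let gradientE x j : gradient g f x 0 j = \sum_i p i x * h i j x.
Proof. by rewrite /gradient mxE; apply: eq_bigr => i _; rewrite mxE. Qed.

Lemma gradient_differentiable x : differentiable (gradient g f) x.
Proof.
apply: differentiable_row => j; under eq_fun do rewrite gradientE.
by apply: differentiable_bigsum => i; apply: differentiableM.
Qed.

Lemma diff_row_coord (F : 'rV[R]_n -> 'rV[R]_n) x v j : differentiable F x ->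
  'd F x v 0 j = 'D_v (fun y => F y 0 j) x.
Proof.
move=> dF; rewrite -deriveE// derive_mx ?mxE//.
exact: diff_derivable.
Qed.

Hypotheses (hcrit : forall v : 'rV[R]_n, 'd f 0 v = 0)
  (hhess : hessian f 0 = diag_mx a) (hg0 : g 0 = 1%:M).

Let p0 i : p i 0 = 0.
Proof. by rewrite /p deriveE ?hcrit//; exact: (hf [::]). Qed.

Lemma gradient0 : gradient g f 0 = 0.
Proof.
by apply/rowP => j; rewrite gradientE mxE big1// => i _; rewrite p0 mul0r.
Qed.

Let dpv i (v : 'rV[R]_n) : 'D_v (p i) 0 = v 0 i * a 0 i.
Proof.
rewrite deriveE// {1}[v]row_sum_delta linear_sum/= (bigD1 i)//= big1 ?addr0.
  rewrite linearZ/= -deriveE//; have /matrixP/(_ i i) := hhess.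
  by rewrite !mxE eqxx mulr1n => ->.
move=> j ji; rewrite linearZ/= -deriveE//; have /matrixP/(_ i j) := hhess.
by rewrite !mxE eq_sym (negPf ji) mulr0n => ->; rewrite scaler0.
Qed.

(** By the product rule: the derivative of the inverse metric is multiplied by the
    differential of f, which vanishes at 0, and the remaining term is the Hessian
    since the metric is Euclidean at 0. *)
Lemma diff_gradient0 v : 'd (gradient g f) 0 v = linfield a v.
Proof.
apply/rowP => j; rewrite diff_row_coord; last exact: gradient_differentiable.
have -> : (fun y => gradient g f y 0 j) = \sum_(i < n) (p i * h i j : 'rV[R]_n -> R).
  by apply/funext => y; rewrite gradientE fct_sumE.
rewrite derive_sum; last first.
  by move=> i; apply: diff_derivable; exact: differentiableM.
rewrite (bigD1 j)//= big1 ?addr0.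
  rewrite deriveM; [|exact: diff_derivable..].
  by rewrite p0 scale0r add0r dpv /h hg0 invmx1 mxE eqxx linfieldE /GRing.scale/= mul1r.
move=> i ij; rewrite deriveM; [|exact: diff_derivable..].
by rewrite p0 scale0r add0r /h hg0 invmx1 mxE (negPf ij) scale0r.
Qed.

End gradient.

Section euclidean.
Context {R : realType} {n : nat}.
Implicit Types (x y : 'rV[R]_n).

Lemma enorm0 : enorm (0 : 'rV[R]_n) = 0.
Proof. by rewrite /enorm big1 ?sqrtr0// => i _; rewrite mxE expr0n. Qed.

Lemma coord_le_enorm x i : `|x 0 i| <= enorm x.
Proof.
rewrite -sqrtr_sqr ler_wsqrtr// (bigD1 i)//= lerDl.
by apply: sumr_ge0 => j _; rewrite sqr_ge0.
Qed.

Lemma coord_le_norm x i : `|x 0 i| <= `|x|.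
Proof.
rewrite [leRHS]mx_normrE; exact: (le_bigmax _ (fun ij : 'I_1 * 'I_n => `|x ij.1 ij.2|) (0, i)).
Qed.

Lemma norm_le_coord x (M : R) : 0 <= M -> (forall i, `|x 0 i| <= M) -> `|x| <= M.
Proof.
move=> M0 xM; rewrite [leLHS]mx_normrE; apply: bigmax_le => //= -[i j] _ /=.
by rewrite (ord1 i).
Qed.

Lemma norm_le_enorm x : `|x| <= enorm x.
Proof. by apply: norm_le_coord (enorm_ge0 x) _ => i; exact: coord_le_enorm. Qed.

Lemma enormZ (b : R) x : enorm (b *: x) = `|b| * enorm x.
Proof.
rewrite /enorm; under eq_bigr do rewrite mxE exprMn.
by rewrite -mulr_sumr sqrtrM ?sqr_ge0// sqrtr_sqr.
Qed.

Lemma enorm_eq0 x : enorm x = 0 -> x = 0.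
Proof.
move=> x0; apply/rowP => i; rewrite mxE; apply/eqP; rewrite -normr_le0 -x0.
exact: coord_le_enorm.
Qed.

Lemma coordB x y i : (x - y) 0 i = x 0 i - y 0 i.
Proof. by rewrite !mxE. Qed.

Lemma enorm_le_sum x : enorm x <= \sum_i `|x 0 i|.
Proof.
have s0 : 0 <= \sum_i `|x 0 i| by exact: sumr_ge0.
rewrite -(@ler_pXn2r _ 2) ?nnegrE ?enorm_ge0// enorm_sqr expr2 mulr_suml.
apply: ler_sum => i _; rewrite -(real_normK (num_real _)) expr2 ler_wpM2l//.
by rewrite (bigD1 i)//= lerDl; exact: sumr_ge0.
Qed.

Lemma enorm_le_norm x : enorm x <= n%:R * `|x|.
Proof.
apply: (le_trans (enorm_le_sum x)); apply: (@le_trans _ _ (\sum_(i < n) `|x|)).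
  by apply: ler_sum => i _; exact: coord_le_norm.
by rewrite sumr_const card_ord mulr_natl.
Qed.

Lemma dot_le_enorm x y : \sum_i x 0 i * y 0 i <= enorm x * enorm y.
Proof.
have [x0|x0] := eqVneq (enorm x) 0.
  rewrite x0 mul0r big1// => i _; have /rowP/(_ i) := enorm_eq0 x0.
  by rewrite mxE => ->; rewrite mul0r.
have [y0|y0] := eqVneq (enorm y) 0.
  rewrite y0 mulr0 big1// => i _; have /rowP/(_ i) := enorm_eq0 y0.
  by rewrite mxE => ->; rewrite mulr0.
have xp : 0 < enorm x by rewrite lt_def x0 enorm_ge0.
have yp : 0 < enorm y by rewrite lt_def y0 enorm_ge0.
have : 0 <= \sum_i (enorm y * x 0 i - enorm x * y 0 i) ^+ 2.
  by apply: sumr_ge0 => i _; rewrite sqr_ge0.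
have -> : \sum_i (enorm y * x 0 i - enorm x * y 0 i) ^+ 2 =
   enorm y ^+ 2 * \sum_i x 0 i ^+ 2 + enorm x ^+ 2 * \sum_i y 0 i ^+ 2
   - 2 * (enorm x * enorm y) * \sum_i x 0 i * y 0 i.
  rewrite !mulr_sumr -sumrN -!big_split/=; apply: eq_bigr => i _; ring.
rewrite -!enorm_sqr; move: (enorm x) (enorm y) xp yp (\sum_i _) => p q p0 q0 B h.
have : 0 <= 2 * (p * q) * (p * q - B) by move: h; nra.
by rewrite pmulr_rge0 ?subr_ge0// !mulr_gt0.
Qed.

(** The supremum that defines the operator norm is that of a bounded set, because a
    linear map is determined by its values on the standard basis. *)
Lemma enorm_le_opnorm (L : 'rV[R]_n -> 'rV[R]_n) x : linear L ->
  enorm (L x) <= opnorm L * enorm x.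
Proof.
move=> linL; pose LM := GRing.isLinear.Build _ _ _ _ L linL.
pose LL : {linear 'rV[R]_n -> 'rV[R]_n} := HB.pack L LM.
have L0 : L 0 = 0 by exact: (linear0 LL).
have LZ b z : L (b *: z) = b *: L z by exact: (linearZZ LL).
have ub : has_ubound [set enorm (L v) | v in [set v : 'rV[R]_n | enorm v <= 1]].
  pose M : R := \sum_j \sum_i `|L (delta_mx 0 j) 0 i|.
  exists M => _ [v /= v1 <-]; apply: (le_trans (enorm_le_sum _)).
  rewrite /M exchange_big/=; apply: ler_sum => i _.
  have -> : L v 0 i = \sum_j v 0 j * L (delta_mx 0 j) 0 i.
    have -> : L v = \sum_j L (v 0 j *: delta_mx 0 j).
      by rewrite {1}[v]row_sum_delta; exact: (linear_sum LL).
    by rewrite summxE; apply: eq_bigr => j _; rewrite LZ mxE.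
  apply: (le_trans (ler_norm_sum _ _ _)); apply: ler_sum => j _.
  by rewrite normrM ler_piMl// (le_trans (coord_le_enorm v j)).
have [x0|x0] := eqVneq (enorm x) 0.
  by rewrite x0 mulr0 (enorm_eq0 x0) L0 enorm0.
have xp : 0 < enorm x by rewrite lt_def x0 enorm_ge0.
rewrite -ler_pdivrMr//; apply: (ub_le_sup ub).
exists ((enorm x)^-1 *: x); rewrite /= ?enormZ ?LZ ?enormZ ger0_norm ?invr_ge0 ?enorm_ge0//.
  by rewrite mulVf.
by rewrite mulrC.
Qed.

(** The difference quotients of both sides are the same functions. *)
Lemma is_derive_line (F : 'rV[R]_n -> R) y (t : R) : differentiable F (t *: y) ->
  is_derive t 1 (fun r => F (r *: y)) ('D_y F (t *: y)).
Proof.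
move=> dF; have df := diff_derivable (v := y) dF.
have E : (fun h : R => h^-1 *: (((fun r => F (r *: y)) \o shift t) (h *: (1 : R)) - F (t *: y))) =
   (fun h => h^-1 *: ((F \o shift (t *: y)) (h *: y) - F (t *: y))).
  apply/funext => h /=; congr (_ *: (F _ - _)).
  by rewrite scalerDl; congr (_ *: _ + _); rewrite /GRing.scale/= mulr1.
apply: DeriveDef; first by rewrite /derivable E.
by rewrite /derive E.
Qed.

(** The mean value theorem for the scalar function t -> <X(t y) - A (t y), e>, where
    e = X y - A y is the vector to be estimated: its increment over [0, 1] is
    |e| ^ 2. *)
Lemma mean_value_linear_approx (a : 'rV[R]_n) (X : 'rV[R]_n -> 'rV[R]_n) y (M : R) :
  (forall x, differentiable X x) -> X 0 = 0 ->
  (forall t, 0 <= t -> t <= 1 ->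
    opnorm (fun v => 'd X (t *: y) v - linfield a v) <= M) ->
  enorm (X y - linfield a y) <= M * enorm y.
Proof.
move=> dX X0 hM; set e := X y - linfield a y.
have step t : 0 <= t -> t <= 1 ->
    enorm ('d X (t *: y) y - linfield a y) <= M * enorm y.
  move=> t0 t1; have lin : linear (fun v => 'd X (t *: y) v - linfield a v).
    by move=> b u v; rewrite linearP linfield_lin scalerB_add.
  exact: le_trans (enorm_le_opnorm y lin) (ler_wpM2r (enorm_ge0 y) (hM t t0 t1)).
have [e0|e0] := eqVneq (enorm e) 0.
  by rewrite e0; apply: le_trans (step 0 (lexx _) ler01); exact: enorm_ge0.
have ep : 0 < enorm e by rewrite lt_def e0 enorm_ge0.
pose G (i : 'I_n) := (fun x : 'rV[R]_n => X x 0 i) - (a 0 i *: (fun x : 'rV[R]_n => x 0 i : R)).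
pose F := \sum_(i < n) (e 0 i *: G i).
have dXi i x : differentiable (fun x => X x 0 i) x.
  have := @differentiable_comp _ _ _ _ X (fun N : 'rV[R]_n => N 0 i : R) x (dX x).
  by apply; exact: differentiable_coord.
have dci i (x : 'rV[R]_n) : differentiable (fun x : 'rV[R]_n => x 0 i : R) x.
  exact: differentiable_coord.
have Dci i (x : 'rV[R]_n) : 'D_y (fun x : 'rV[R]_n => x 0 i : R) x = y 0 i.
  have := @derive_mx _ _ _ _ (id : 'rV[R]_n -> 'rV[R]_n) x y (@derivable_id _ _ _ _).
  by rewrite derive_id => /rowP/(_ i); rewrite mxE => <-.
have dG i x : differentiable (G i) x.
  by apply: differentiableB => //; exact: differentiableZ.
have dF x : differentiable F x by apply: differentiable_sum => i; exact: differentiableZ.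
have FE x : F x = \sum_i (X x - linfield a x) 0 i * e 0 i.
  rewrite /F fct_sumE; apply: eq_bigr => i _; rewrite (coordB (X x)) linfieldE /G !fctE /GRing.scale/=; ring.
have DF x : 'D_y F x = \sum_i ('d X x y - linfield a y) 0 i * e 0 i.
  rewrite /F derive_sum; last by move=> i; apply: diff_derivable; exact: differentiableZ.
  apply: eq_bigr => i _; rewrite deriveZ; last exact: diff_derivable.
  rewrite /G deriveB; [|exact: diff_derivable|by apply: diff_derivable; exact: differentiableZ].
  rewrite -diff_row_coord// deriveZ; last exact: diff_derivable.
  rewrite Dci (coordB ('d X x y)) linfieldE /GRing.scale/=; ring.
have dline r := is_derive_line (y := y) (dF (r *: y)).
have cF := is_derive_continuous dline.
have [t] := @MVT_segment _ (fun r => F (r *: y)) (fun r => 'D_y F (r *: y)) 0 1 ler01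
  (fun r _ => dline r) (continuous_subspaceT cF).
rewrite in_itv/= => /andP[t0 t1]; rewrite scale1r scale0r subr0 mulr1 !FE DF.
rewrite [X in _ - X]big1 ?subr0; last first.
  by move=> i _; rewrite coordB X0 linfieldE mxE mul0r subr0 mul0r.
have -> : \sum_i (X y - linfield a y) 0 i * e 0 i = enorm e ^+ 2.
  by rewrite enorm_sqr; apply: eq_bigr => i _; rewrite expr2.
move=> h; have h1 := dot_le_enorm ('d X (t *: y) y - linfield a y) e.
have h2 := step t t0 t1.
rewrite -(ler_pM2r ep) -expr2 h; apply: (le_trans h1).
by rewrite ler_pM2r.
Qed.

(** Differentiability at 0, with the sup norm of row vectors replaced by the
    Euclidean norm. *)
Lemma enorm_approx_at0 (a : 'rV[R]_n) (X : 'rV[R]_n -> 'rV[R]_n) (e : R) : 0 < e ->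
  differentiable X 0 -> X 0 = 0 -> (forall v, 'd X 0 v = linfield a v) ->
  exists2 r : R, 0 < r & forall y, `|y| < r ->
    enorm (X y - linfield a y) <= e * enorm y.
Proof.
move=> e0 dX X0 dX0.
(* n is the constant of the comparison of the Euclidean norm with the sup norm;
   adding 1 covers the case n = 0. *)
pose e' := e / (n%:R + 1).
have n1 : 0 < n%:R + 1 :> R by rewrite ltr_wpDl.
have e'0 : 0 < e' by rewrite divr_gt0.
have := diff_locally dX => /eqaddoP /(_ e' e'0).
rewrite near_simpl => /nbhs_ballP[r /= r0 hr]; exists r => // y yr.
have := hr y; rewrite /= -ball_normE /= sub0r normrN => /(_ yr).
rewrite !fctE/= X0 add0r addr0 dX0 => h.
apply: (le_trans (enorm_le_norm _)).
apply: (@le_trans _ _ (n%:R * (e' * enorm y))).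
  by rewrite ler_wpM2l// (le_trans h)// ler_wpM2l ?norm_le_enorm// ltW.
rewrite mulrA ler_wpM2r ?enorm_ge0// /e' mulrCA ger_pMr// ler_pdivrMr// mul1r lerDl//.
Qed.

End euclidean.

(** * Perturbations of bounded linear maps *)

Section differential.
Context {R : realType} {V W : normedModType R}.

(** A bounded linear map that approximates Phi to first order at 0 is its Frechet
    differential there. *)
Lemma bounded_linear_approx_diff (L Phi : V -> W) (K : R) : linear L ->
  (forall v, `|L v| <= K * `|v|) -> Phi 0 = 0 ->
  (forall e, 0 < e -> \forall v \near (0 : V), `|Phi v - L v| <= e * `|v|) ->
  differentiable Phi 0 /\ 'd Phi 0 = L :> (V -> W).
Proof.
move=> linL LK Phi0 PhiL.
pose LM := GRing.isLinear.Build _ _ _ _ L linL.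
pose LL : {linear V -> W} := HB.pack L LM.
have cL : continuous LL.
  apply/linear_bounded_continuous/linear_boundedP.
  exists K; split; first exact: num_real.
  by move=> r /ltW Kr x; apply: (le_trans (LK x)); exact: ler_wpM2r.
have E : Phi \o shift 0 = cst (Phi 0) + (LL : V -> W) +o_ (0 : V) id.
  apply/eqaddoP => e e0; near=> v.
  rewrite !fctE/= Phi0 addr0 add0r.
  by near: v; exact: PhiL.
have D : 'd Phi 0 = LL :> (V -> W) by exact: diff_unique.
by split => //; apply/diff_locallyP; rewrite D.
Unshelve. all: by end_near. Qed.

Lemma bounded_linear_diff (L : V -> W) (K : R) : linear L ->
  (forall v, `|L v| <= K * `|v|) ->
  differentiable L 0 /\ 'd L 0 = L :> (V -> W).
Proof.
move=> linL LK; apply: (bounded_linear_approx_diff linL LK).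
  by apply/eqP; rewrite -normr_le0 (le_trans (LK 0))// normr0 mulr0.
by move=> e e0; near=> v; rewrite subrr normr0 mulr_ge0// ltW.
Unshelve. all: by end_near. Qed.

End differential.

(** * The Newton-Picard map near the constant path *)

Section main.
Context {R : realType} {n : nat} (k : nat).

Lemma constant_solution0 (X : 'rV[R]_n -> 'rV[R]_n) (I : interval R) : X 0 = 0 ->
  solutions X I 0.
Proof.
move=> X0; have := weak_derivative_uniq (W12_wderivP (0 : W12 n I)) (weak_derivative0 I).
by apply: ae_sub => s h /h; rewrite /flowop => ->; rewrite X0 addr0.
Qed.

Lemma KT0 (T : R) : KT k T (0 : WT n T).
Proof. by move=> i; case: ifP => _; rewrite mxE. Qed.

Variables (X : 'rV[R]_n -> 'rV[R]_n) (a : 'rV[R]_n) (c delta T : R).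
Hypotheses (dX : forall x, differentiable X x) (X0 : X 0 = 0)
  (dX0 : forall v, 'd X 0 v = linfield a v)
  (T0 : 0 < T) (c0 : 0 < c)
  (hQ : forall v : R -> 'rV[R]_n, L2fun `[- T, T] v ->
    `|QT k T a v| <= c * L2norm `[- T, T] v)
  (hX : forall w : WT n T, `|w| < delta -> forall s : R, s \in `[- T, T] ->
    opnorm (fun v => 'd X (w s) v - linfield a v) < 1 / (4 * c)).

(** With 1 / (4 c) as the bound on the nonlinearity, newton_picard_close gives
    |z| <= |Pi_T u| + |z| / 4. *)
Lemma newton_picard_norm_le (u z : WT n T) : solutions X `[- T, T] z ->
  KT k T (z - u) -> `|z| < delta -> `|z| <= 2 * `|PiT k T a u|.
Proof.
move=> zX zK zd.
have M0 : 0 <= 1 / (4 * c) by rewrite divr_ge0// mulr_ge0// ltW.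
have h s : s \in `[- T, T] -> enorm (X (z s) - linfield a (z s)) <= 1 / (4 * c) * enorm (z s).
  move=> sJ; apply: mean_value_linear_approx => // t t0 t1; apply: ltW.
  have tz : `|t *: z| < delta.
    by rewrite normrZ ger0_norm//; apply: le_lt_trans zd; rewrite ler_piMl.
  exact: (hX tz sJ).
have := newton_picard_close T0 c0 hQ M0 zX zK h.
have -> : c * (1 / (4 * c)) = 4^-1 by field; rewrite gt_eqF.
have : `|z| <= `|z - PiT k T a u| + `|PiT k T a u|.
  by rewrite -{1}(subrK (PiT k T a u) z) ler_normD.
have := normr_ge0 (PiT k T a u); have := normr_ge0 z.
by move: `|z - _| `|z| `|PiT _ _ _ _| => x y p; lra.
Qed.

(** Smallness of Pi_T u makes z small in W^{1,2}, hence uniformly small, and then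
    the nonlinearity along z is an arbitrarily small multiple of z. *)
Lemma newton_picard_first_order (e : R) : 0 < e -> exists2 r : R, 0 < r &
  forall u z : WT n T, `|PiT k T a u| < r ->
    solutions X `[- T, T] z -> KT k T (z - u) -> `|z| < delta ->
    `|z - PiT k T a u| <= e * `|PiT k T a u|.
Proof.
move=> e0; have NT : - T < T by rewrite (lt_trans _ T0)// oppr_lt0.
have [K K0 hK] := W12_sup_bound (n := n) NT.
(* The factor c comes from the bound on Q_T, the factor 2 from |z| <= 2 |Pi_T u|. *)
pose e' := e / (c * 2).
have e'0 : 0 < e' by rewrite divr_gt0// mulr_gt0.
have [r r0 hr] := enorm_approx_at0 e'0 (dX 0) X0 dX0.
exists (r / (K * 2)) => [|u z ur zX zK zd]; first by rewrite divr_gt0// mulr_gt0.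
have z2 := newton_picard_norm_le zX zK zd.
have h s : s \in `[- T, T] -> enorm (X (z s) - linfield a (z s)) <= e' * enorm (z s).
  move=> sJ; apply: hr; apply: le_lt_trans (_ : _ <= K * `|z|) _.
    by apply: norm_le_coord => [|i]; [rewrite mulr_ge0// ltW|exact: hK].
  apply: le_lt_trans (ler_wpM2l (ltW K0) z2) _.
  by rewrite mulrA mulrC -ltr_pdivlMr// mulr_gt0.
have := newton_picard_close T0 c0 hQ (ltW e'0) zX zK h.
move/le_trans; apply.
have -> : c * e' = e / 2 by rewrite /e'; field; rewrite gt_eqF.
apply: le_trans (ler_wpM2l _ z2) _; first by rewrite divr_ge0// ltW.
by rewrite mulrA divfK.
Qed.

End main.

Unset Implicit Arguments.

Theorem lemma5p2
  (R : realType) (n k : nat)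
  (f : 'rV[R]_n -> R) (g : 'rV[R]_n -> 'M[R]_n) (a : 'rV[R]_n)
  (beta : R -> R) (c delta : R)
  (Up : set (Wplus R n)) (Um : set (Wminus R n))
  (epsilon C T0 : R)
  (N : forall T : R, WT n T -> WT n T)
  (hf : smooth f)
  (hcrit : forall v : 'rV[R]_n, 'd f 0 v = 0)
  (hhess : hessian f 0 = diag_mx a)
  (hk : (k <= n)%N)
  (ha_mono : forall i j : 'I_n, (i <= j)%N -> a 0 j <= a 0 i)
  (ha_sign : forall i : 'I_n, if (i < n - k)%N then 0 < a 0 i else a 0 i < 0)
  (hg : riemannian_metric g)
  (hg0 : g 0 = 1%:M)
  (hbeta : smooth beta)
  (hbeta01 : forall s : R, 0 <= beta s <= 1)
  (hbeta0 : forall s : R, s <= -1 -> beta s = 0)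
  (hbeta1 : forall s : R, 1 <= s -> beta s = 1)
  (hc : 0 < c)
  (hQ : forall T : R, 0 < T -> forall v : R -> 'rV[R]_n, L2fun `[- T, T] v ->
    `|QT k T a v| <= c * L2norm `[- T, T] v)
  (hdelta : 0 < delta)
  (hdelta_close : forall T : R, 1 <= T -> forall w : WT n T, `|w| < delta ->
    forall s : R, s \in `[- T, T] ->
    opnorm (fun v => 'd (gradient g f) (w s) v - linfield a v) < 1 / (4 * c))
  (hN : forall T : R, T0 <= T -> newton_picard_map k T (gradient g f) c delta (N T))
  (hUp : exists2 O : set (Wplus R n), open O &
    Up = solutions (gradient g f) `[0, +oo[ `&` O)
  (hUm : exists2 O : set (Wminus R n), open O &
    Um = solutions (gradient g f) `]-oo, 0] `&` O)
  (hUp0 : Up 0)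
  (hUm0 : Um 0)
  (hKp : compact (solutions (gradient g f) `[0, +oo[ `&` closure Up))
  (hKm : compact (solutions (gradient g f) `]-oo, 0] `&` closure Um))
  (hU : forall wp wm (T : R), Up wp -> Um wm -> 3 <= T ->
    `|preglue T beta (wp, wm)| < delta / 8)
  (heps : 0 < epsilon < inf (range (fun i : 'I_n => `|a 0 i|)))
  (hC : forall wp wm (T : R),
    (solutions (gradient g f) `[0, +oo[ `&` closure Up) wp ->
    (solutions (gradient g f) `]-oo, 0] `&` closure Um) wm -> 3 <= T ->
    L2norm `[- T, T] (flowop (gradient g f) (preglue T beta (wp, wm)))
      <= C * expR (- (epsilon * T)))
  (hT0 : 3 <= T0)
  (hT0C : C * expR (- (epsilon * T0)) < delta / (4 * c))
  (T : R) (hT : T0 <= T) :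
  let Ws := solutions (gradient g f) `[0, +oo[ in
  let Wu := solutions (gradient g f) `]-oo, 0] in
  let Ep := solutions (linfield a) `[0, +oo[ in
  let Em := solutions (linfield a) `]-oo, 0] in
  let ET := solutions (linfield a) `[- T, T] in
  let gammaT := N T \o preglue T beta in
  [/\ gammaT (0, 0) = 0,
      diff_along (Ws `*` Wu) (Ep `*` Em) (0, 0)
        (preglue T beta) ('d (preglue T beta) (0, 0)),
      diff_along (Up `*` Um) (Ep `*` Em) (0, 0) gammaT (Gamma k T a beta) &
      forall w, (Ep `*` Em) w -> ET (Gamma k T a beta w)].
Proof.
move=> Ws Wu Ep Em ET gammaT.
pose X := gradient g f.
have T3 : 3 <= T := le_trans hT0 hT.
have T0' : 0 < T by apply: lt_le_trans T3.
have T1 : 1 <= T by apply: le_trans T3; rewrite ler1n.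
have dX x : differentiable X x by exact: gradient_differentiable.
have X0 : X 0 = 0 by exact: gradient0.
have dX0 v : 'd X 0 v = linfield a v by exact: diff_gradient0.
have hQT := hQ T T0'.
have [Kp Kp0 hKp'] := preglue_bounded (n := n) T0' hbeta.
have [KP KP0 hKP] := PiT_bounded T0' hc hQT.
have linp : linear (preglue T beta : Wplus R n * Wminus R n -> WT n T).
  exact: preglue_linear.
have [dp dpE] := bounded_linear_diff linp hKp'.
have p0 : preglue T beta (0, 0) = 0 :> WT n T.
  by apply/eqP; rewrite -normr_le0 (le_trans (hKp' _))// normr0 mulr0.
have dom w : (Up `*` Um) w -> newton_picard_domain T X c delta (preglue T beta w).
  case: w => wp wm [/= Upw Umw]; split; first exact: hU.
  have sp : (solutions X `[0, +oo[ `&` closure Up) wp.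
    by split; [case: hUp Upw => O _ -> []|exact: subset_closure].
  have sm : (solutions X `]-oo, 0] `&` closure Um) wm.
    by split; [case: hUm Umw => O _ -> []|exact: subset_closure].
  apply: le_lt_trans (hC wp wm T sp sm T3) _.
  (* The right-hand side decreases in T only if C is nonnegative. *)
  have [C0|C0] := leP C 0.
    apply: (@le_lt_trans _ _ 0); first by rewrite mulr_le0_ge0// expR_ge0.
    by rewrite divr_gt0// mulr_gt0.
  apply: le_lt_trans hT0C; rewrite ler_pM2l// ler_expR lerN2 ler_pM2l//.
  by case/andP: heps.
have gam w : (Up `*` Um) w ->
    [/\ solutions X `[- T, T] (gammaT w), KT k T (gammaT w - preglue T beta w) &
        `|gammaT w| < delta].
  by move=> Uw; have [] := hN T hT _ (dom w Uw).
have U0 : (Up `*` Um) (0, 0) by [].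
have gam0 : gammaT (0, 0) = 0.
  have [_ un] := hN T hT _ (dom _ U0); apply: un; split.
  - exact: constant_solution0.
  - by rewrite p0 subr0; exact: KT0.
  - by rewrite normr0.
split=> //.
- exists (preglue T beta); split; [by near=> w => _|exact: dp|by rewrite dpE].
- pose L w := PiT k T a (preglue T beta w).
  (* The ambient extension of the gluing map: off the domain of the gluing map it
     is the expected differential, so that only glued paths have to be estimated. *)
  pose Phi w := if `[< (Up `*` Um) w >] then gammaT w else L w.
  have linL : linear L by move=> b u v; rewrite /L linp PiT_linear.
  have LK w : `|L w| <= KP * Kp * `|w|.
    by apply: (le_trans (hKP _)); rewrite -mulrA ler_wpM2l.
  have Phi0 : Phi 0 = 0 by rewrite /Phi asboolT.
  have PhiL e : 0 < e -> \forall w \near (0 : Wplus R n * Wminus R n),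
      `|Phi w - L w| <= e * `|w|.
    move=> e0; pose K := KP * Kp + 1.
    have K0 : 0 < K by rewrite ltr_wpDl// mulr_ge0.
    have LK' w : `|L w| <= K * `|w|.
      by apply: (le_trans (LK w)); rewrite ler_wpM2r// lerDl.
    have [r r0 hr] := newton_picard_first_order dX X0 dX0 T0' hc hQT
      (hdelta_close T T1) (divr_gt0 e0 K0).
    have small : \forall w \near (0 : Wplus R n * Wminus R n), `|w| < r / K.
      exact: (nbhs0_lt (V := (Wplus R n * Wminus R n)%type) (divr_gt0 r0 K0)).
    apply: filterS small => w small; rewrite /Phi; case: asboolP => Uw; last first.
      by rewrite subrr normr0 mulr_ge0// ltW.
    have [s1 s2 s3] := gam w Uw.
    apply: (le_trans (hr _ _ _ s1 s2 s3)).
      by apply: le_lt_trans (LK' w) _; rewrite mulrC -ltr_pdivlMr.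
    by have := ler_wpM2l (ltW (divr_gt0 e0 K0)) (LK' w); rewrite mulrA divfK// gt_eqF.
  have [dPhi dPhiE] := bounded_linear_approx_diff linL LK Phi0 PhiL.
  exists Phi; split => //.
    by near=> w => Uw; rewrite /Phi asboolT.
  by move=> v _; rewrite dPhiE /Gamma dpE.
- by move=> w _; have [] := PiTP a k T0' ('d (preglue T beta) (0, 0) w).
Unshelve. all: by end_near. Qed.
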